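(* Let $a,c\in\mathbb{C}$ and $\beta:=\frac{a+c-1}{2}$, with $c,\beta\notin\{0,-1,-2,\dots\}$, and let $y:=\frac{-4x}{(1-x)^2}$. Then, as operators on $C^\omega$, $$(1-x)^{2\beta}\,\mathcal{H}_c^a(x)\,(1-x)^{-2\beta}=\mathcal{H}_c^{\beta}(y)\,(1-y)^{-\frac{c-a}{2}}\,\mathcal{H}_{\beta}^{a}(y).$$
   Context: $C^\omega$ is the space of (germs of) functions analytic near $0\in\mathbb{C}$. $(q)_n=q(q+1)\cdots(q+n-1)$, $(q)_0=1$. For $a,c\in\mathbb{C}$ with $c\notin\{0,-1,-2,\dots\}$ the hypergeometrization is the linear operator $\mathcal{H}_c^a:C^\omega\to C^\omega$, $\mathcal{H}_c^a\left(\sum_n f_nx^n\right)=\sum_n f_n\frac{(a)_n}{(c)_n}x^n$; it is also denoted $\mathcal{H}_c^a(x)$. If $y=y(x)$ is analytic near $0$ with $y(0)=0$, $y'(0)\neq0$, then every $f\in C^\omega$ is uniquely $f=g\circ y$ with $g\in C^\omega$, and $\mathcal{H}_c^a(y)f:=(\mathcal{H}_c^a g)\circ y$. A function $h\in C^\omega$ written in an operator expression denotes multiplication by $h$, and juxtaposition denotes composition. Complex powers of functions equal to $1$ at $0$ are the branches with value $1$ at $0$. *)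

(* Defs.v *)
(* Based on the Stdlib reals and Coquelicot's complex numbers C. *)
From Stdlib Require Import Reals ClassicalEpsilon.
From Coquelicot Require Import Coquelicot.
Open Scope C_scope.

(* A germ at 0 is represented by any function C -> C having that germ;
   [germ_eq] is equality of germs.  The values of such functions away from 0
   are irrelevant. *)
Definition germ_eq (f g : C -> C) : Prop :=
  locally (0 : C) (fun x : C => f x = g x).

Definition has_expansion (u : nat -> C) (f : C -> C) : Prop :=
  locally (0 : C)
    (fun x : C => @is_pseries C_AbsRing C_NormedModule u x (f x)).

Definition analytic0 (f : C -> C) : Prop :=
  exists u : nat -> C, has_expansion u f.

(* Equality as operators on the space of analytic germs: both sides map this
   space to itself, and they agree there. *)
Definition op_eq (A B : (C -> C) -> (C -> C)) : Prop :=
  forall f : C -> C, analytic0 f ->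
    analytic0 (A f) /\ analytic0 (B f) /\ germ_eq (A f) (B f).

Definition mul_op (h : C -> C) (f : C -> C) : C -> C := fun x => h x * f x.

Fixpoint pochhammer (q : C) (n : nat) : C :=
  match n with
  | O => 1
  | S m => pochhammer q m * (q + INR m)
  end.

(* [0, -1, -2, ...] *)
Definition nonpos_integer (q : C) : Prop :=
  exists n : nat, q = RtoC (- INR n).

Definition is_hypergeometrization (a c : C) (f g : C -> C) : Prop :=
  exists u : nat -> C,
    has_expansion u f /\
    has_expansion (fun n => u n * (pochhammer a n / pochhammer c n)) g.

(* For f analytic at 0 and c not a nonpositive integer, the germ of g in
   [is_hypergeometrization a c f g] exists and is unique; [epsilon] picks a
   function representing it. *)
Definition hypergeometrization (a c : C) (f : C -> C) : C -> C :=
  epsilon (inhabits f) (is_hypergeometrization a c f).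

(* The g with f = g o y as germs; it exists and is unique as a germ when f and
   y are analytic at 0, y 0 = 0 and the derivative of y at 0 is nonzero. *)
Definition in_coordinate (y : C -> C) (f : C -> C) : C -> C :=
  epsilon (inhabits f)
    (fun g => analytic0 g /\ germ_eq f (fun x => g (y x))).

Definition hypergeometrization_at (a c : C) (y : C -> C) (f : C -> C) : C -> C :=
  fun x => hypergeometrization a c (in_coordinate y f) (y x).

Definition Cexp (z : C) : C :=
  ((exp (Re z) * cos (Im z))%R, (exp (Re z) * sin (Im z))%R).

(* Principal logarithm on the complement of ]-oo, 0]: the half-angle formula
   arg z = 2 atan (Im z / (|z| + Re z)) gives the argument in ]-PI, PI[.  The
   values on ]-oo, 0] are meaningless. *)
Definition Clog (z : C) : C :=
  (ln (Cmod z), (2 * atan (Im z / (Cmod z + Re z)))%R).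

(* Principal power.  If h is analytic at 0 with h 0 = 1, then near 0
   [fun x => Cpower (h x) s] is the branch of h ^ s with value 1 at 0. *)
Definition Cpower (z s : C) : C := Cexp (s * Clog z).

(* Main.v *)
Require Import Defs.
From Stdlib Require Import Reals Factorial Arith Lra Lia ClassicalEpsilon.
From Coquelicot Require Import Coquelicot.
Open Scope C_scope.

(** Put beta = (a+c-1)/2, p = 1 - x, and (q)_n for the Pochhammer symbol.  Both
    sides of the identity are diagonal in the functions e_n = x^n p^(2 beta),
    n = 0, 1, ..., with the same eigenvalues (a)_n / (c)_n.

    For the left-hand operator this is immediate: multiplication by p^(-2 beta)
    turns e_n into x^n.

    For the right-hand operator, e_n must be written in the coordinate y.  From
    y = -4x / (1-x)^2 one gets x = (-y/4) p^2, hence e_n = (-y/4)^n p^(2(beta+n)),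
    and p = 1 + (y/4) p^2.  The latter equation says that the powers of p are
    generating functions of Catalan type: the coefficient of (y/4)^k in p^s is
    s (s+k+1)_(k-1) / k! ([catalan_coef]).  As a hypergeometric series,
    p^(2b) = F(b, b + 1/2; 2b + 1; y).  Now the three factors of the operator act
    on y^n F(beta+n, beta+n+1/2; 2 beta+2n+1; y) in turn:
    - the inner one multiplies by (a)_n / (beta)_n and changes the parameter
      beta+n into a+n;
    - multiplication by (1-y)^(-(c-a)/2) changes a+n into c+n, by Euler's
      transformation F(A,B;C;y) = (1-y)^(C-A-B) F(C-A,C-B;C;y);
    - the outer one multiplies by (beta)_n / (c)_n and changes c+n back into
      beta+n.
    The result is ((a)_n / (c)_n) e_n.

    Euler's transformation is used through the resulting identity between
    coefficients, [euler_coef], which is the Pfaff-Saalschuetz sum and has a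
    telescoping proof.  The denominators (2 beta+2n+1)_k can vanish under the
    hypotheses, but they cancel in the coefficients of p^s; the identity that is
    needed is polynomial in beta, so it extends by continuity
    ([euler_identity_all]).  That p^s has the stated expansion in y comes down to
    the vanishing of the N-th difference of a polynomial of degree N-1
    ([catalan_coef_binom_sum], [catalan_coef_series]).

    Passing from the e_n to an arbitrary germ f = p^(2 beta) sum v_n x^n means
    summing infinitely many series in y.  All double series that occur (products of
    germs, p^s in the coordinate y, and f itself) are bounded by K q^k q^m and are
    rearranged by one Fubini lemma, [pser_rows_diagonals].  It gives the
    coefficients of f in the coordinate y ([y_coef], [y_coef_expansion]), and the
    theorem reduces to [y_coef_hypergeometrization], an identity of finite sums.
    The germs picked by the choice operator are identified through the uniqueness
    of coefficients ([pser_coef_unique]), and the complex powers are expanded by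
    the binomial series ([binomial_series]). *)

(** * Finite sums and Pochhammer symbols *)

(** [sum_n] over complex numbers is typed in the carrier of an abelian monoid, which
    [ring] and [field] do not recognise; this states the goal in [C] itself. *)
Ltac at_C := match goal with |- @eq _ ?a ?b => change (@eq C a b) end.
Ltac cring := at_C; ring.
Ltac cfield := at_C; field.

Lemma sumC_O (f : nat -> C) : sum_n f 0 = f 0%nat.
Proof. apply sum_O. Qed.

Lemma sumC_S (f : nat -> C) (n : nat) : sum_n f (S n) = sum_n f n + f (S n).
Proof. rewrite sum_Sn. reflexivity. Qed.

Lemma sumC_plus (f g : nat -> C) (n : nat) :
  sum_n (fun k => f k + g k) n = sum_n f n + sum_n g n.
Proof. exact (sum_n_plus f g n). Qed.

Lemma sumC_mult (a : C) (f : nat -> C) (n : nat) :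
  sum_n (fun k => a * f k) n = a * sum_n f n.
Proof. exact (sum_n_mult_l a f n). Qed.

Lemma sumC_minus (f g : nat -> C) (n : nat) :
  sum_n (fun k => f k - g k) n = sum_n f n - sum_n g n.
Proof.
  induction n as [|n IH].
  - now rewrite !sumC_O.
  - rewrite !sumC_S, IH. cring.
Qed.

Lemma sumC_first (f : nat -> C) (n : nat) :
  sum_n f (S n) = f 0%nat + sum_n (fun k => f (S k)) n.
Proof.
  induction n as [|n IH].
  - now rewrite sumC_S, !sumC_O.
  - rewrite sumC_S, IH, sumC_S. cring.
Qed.

(** Both sides sum [X] over the triangle n + m <= M, by diagonals on the left and by
    rows on the right. *)
Lemma sum_triangle (X : nat -> nat -> C) (M : nat) :
  sum_n (fun N => sum_n (fun n => X n (N - n)%nat) N) M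
  = sum_n (fun n => sum_n (fun m => X n m) (M - n)) M.
Proof.
  induction M as [|M IH].
  - now rewrite !sumC_O.
  - rewrite sumC_S, IH, (sumC_S (fun n => X n (S M - n)%nat)),
      (sumC_S (fun n => sum_n (fun m => X n m) (S M - n))), Nat.sub_diag.
    rewrite Cplus_assoc, <- sumC_plus, sumC_O. f_equal.
    apply sum_n_ext_loc. intros n Hn.
    replace (S M - n)%nat with (S (M - n)) by lia. now rewrite sumC_S.
Qed.

Lemma pochhammer_head (q : C) (n : nat) :
  pochhammer q (S n) = q * pochhammer (q + 1) n.
Proof.
  induction n as [|n IH].
  - simpl. cring.
  - change (pochhammer q (S n) * (q + INR (S n))
            = q * (pochhammer (q + 1) n * (q + 1 + INR n))).
    rewrite IH, S_INR, RtoC_plus. cring.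
Qed.

(** This splitting is what turns (a)_(n+m) into (a)_n (a+n)_m, that is, a shift of
    the index into a shift of the parameter. *)
Lemma pochhammer_add (q : C) (n m : nat) :
  pochhammer q (n + m) = pochhammer q n * pochhammer (q + INR n) m.
Proof.
  induction m as [|m IH].
  - rewrite Nat.add_0_r. simpl. cring.
  - rewrite Nat.add_succ_r. simpl. rewrite IH, plus_INR, RtoC_plus. cring.
Qed.

Lemma pochhammer_neq_0 (q : C) (n : nat) :
  ~ nonpos_integer q -> pochhammer q n <> 0.
Proof.
  intros Hq. induction n as [|n IH].
  - apply C1_nz.
  - apply Cmult_neq_0; [exact IH|]. intros H. apply Hq. exists n.
    rewrite RtoC_opp.
    replace q with (q + INR n - INR n) by cring. rewrite H. cring.
Qed.

Lemma nonpos_integer_shift (q : C) (n : nat) :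
  ~ nonpos_integer q -> ~ nonpos_integer (q + INR n).
Proof.
  intros Hq [m Hm]. apply Hq. exists (n + m)%nat.
  rewrite plus_INR, Ropp_plus_distr, RtoC_plus, <- Hm, RtoC_opp. cring.
Qed.

Lemma INR_C_neq_0 (n : nat) : (0 < n)%nat -> RtoC (INR n) <> 0.
Proof. intros Hn H. apply RtoC_inj in H. apply lt_INR in Hn. simpl in Hn. lra. Qed.

Lemma Cmult_reg_l (z u v : C) : z <> 0 -> z * u = z * v -> u = v.
Proof.
  intros Hz E. rewrite <- (Cmult_1_l u), <- (Cinv_l z Hz), <- Cmult_assoc, E.
  rewrite Cmult_assoc, Cinv_l by exact Hz. apply Cmult_1_l.
Qed.

Lemma fact_C_neq_0 (n : nat) : RtoC (INR (fact n)) <> 0.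
Proof. apply INR_C_neq_0, lt_O_fact. Qed.

Lemma fact_C_S (n : nat) :
  RtoC (INR (fact (S n))) = (INR n + 1) * INR (fact n).
Proof. now rewrite fact_simpl, mult_INR, S_INR, RtoC_mult, RtoC_plus. Qed.

Lemma S_C_neq_0 (n : nat) : RtoC (INR n) + 1 <> 0.
Proof. rewrite <- RtoC_plus, <- S_INR. apply INR_C_neq_0. lia. Qed.
(** * Euler's transformation of the hypergeometric series, on coefficients *)

(** The Taylor coefficients of (1-x)^(-s). *)
Definition binom_coef (s : C) (n : nat) : C := pochhammer s n / INR (fact n).

Lemma binom_coef_S (s : C) (n : nat) :
  (INR n + 1) * binom_coef s (S n) = (s + INR n) * binom_coef s n.
Proof.
  unfold binom_coef. rewrite fact_C_S. simpl pochhammer. cfield.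
  split; [apply fact_C_neq_0 | apply S_C_neq_0].
Qed.

(** The Taylor coefficients of the hypergeometric series F(P, Q; K; x). *)
Definition hyper_coef (P Q K : C) (n : nat) : C :=
  pochhammer P n * pochhammer Q n / (pochhammer K n * INR (fact n)).

Lemma hyper_coef_S (P Q K : C) (n : nat) : ~ nonpos_integer K ->
  (K + INR n) * (INR n + 1) * hyper_coef P Q K (S n)
  = (P + INR n) * (Q + INR n) * hyper_coef P Q K n.
Proof.
  intros HK. unfold hyper_coef. rewrite fact_C_S. simpl pochhammer.
  assert (H1 := pochhammer_neq_0 K n HK). assert (H2 := pochhammer_neq_0 K (S n) HK).
  simpl in H2. cfield. repeat split.
  - apply fact_C_neq_0.
  - exact H1.
  - apply S_C_neq_0.
  - intros H. apply H2. rewrite H. cring.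
Qed.

(** The summand of [euler_coef] satisfies the same first-order recurrence in j as its
    sum, up to a difference in i (a Wilf-Zeilberger pair).  The certificate is
    G(j,i) = - i (K+i-1) binom_coef D (j+1-i) hyper_coef P Q K i; since G(j,0) = 0,
    the partial sum over i <= n is G(j,n+1), rewritten here with [hyper_coef_S].
    Setting j = n + d keeps the subtraction of naturals away. *)
Lemma euler_telescope (P Q K : C) (n d : nat) : ~ nonpos_integer K ->
  let D := K - P - Q in
  let j := (n + d)%nat in
  sum_n (fun i => (K + INR j) * (INR j + 1)
                    * (binom_coef D (S j - i) * hyper_coef P Q K i)
                  - (K - P + INR j) * (K - Q + INR j)
                    * (binom_coef D (j - i) * hyper_coef P Q K i)) n
  = - ((P + INR n) * (Q + INR n) * binom_coef D d * hyper_coef P Q K n).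
Proof.
  intros HK D. revert d.
  induction n as [|n IH]; intros d j.
  - rewrite sumC_O. replace (S j - 0)%nat with (S d) by (unfold j; lia).
    replace (j - 0)%nat with d by (unfold j; lia). change j with d.
    transitivity (((K + INR d) * ((INR d + 1) * binom_coef D (S d))
       - (K - P + INR d) * (K - Q + INR d) * binom_coef D d) * hyper_coef P Q K 0).
    { cring. }
    rewrite binom_coef_S. unfold D. simpl INR. cring.
  - rewrite sumC_S. unfold j. rewrite Nat.add_succ_comm.
    rewrite IH. clear IH.
    replace (S (n + S d) - S n)%nat with (S d) by lia.
    replace (n + S d - S n)%nat with d by lia.
    assert (H1 := hyper_coef_S P Q K n HK). assert (H2 := binom_coef_S D d).
    assert (H0 := S_C_neq_0 d).
    assert (H3 : binom_coef D (S d) = (D + INR d) * binom_coef D d / (INR d + 1)).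
    { rewrite <- H2. cfield. exact H0. }
    transitivity (- ((P + INR n) * (Q + INR n) * hyper_coef P Q K n) * binom_coef D (S d)
      + ((K + INR (n + S d)) * (INR (n + S d) + 1)
           * (binom_coef D (S d) * hyper_coef P Q K (S n))
         - (K - P + INR (n + S d)) * (K - Q + INR (n + S d))
           * (binom_coef D d * hyper_coef P Q K (S n)))).
    { cring. }
    rewrite <- H1, H3, plus_INR, !S_INR, !RtoC_plus. unfold D. cfield. exact H0.
Qed.

(** Comparison of coefficients in
    (1-x)^(P+Q-K) F(P, Q; K; x) = F(K-P, K-Q; K; x).  Both sides satisfy the
    recurrence (K+j)(j+1) u_(j+1) = (K-P+j)(K-Q+j) u_j and agree at j = 0. *)
Lemma euler_coef (P Q K : C) (j : nat) : ~ nonpos_integer K ->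
  sum_n (fun i => binom_coef (K - P - Q) (j - i) * hyper_coef P Q K i) j
  = hyper_coef (K - P) (K - Q) K j.
Proof.
  intros HK. induction j as [|j IH].
  - rewrite sumC_O. unfold binom_coef, hyper_coef. simpl. cfield.
  - assert (E := euler_telescope P Q K j 0 HK). cbv zeta in E.
    rewrite Nat.add_0_r in E.
    rewrite sumC_minus, !sumC_mult, IH in E.
    rewrite sumC_S, Nat.sub_diag.
    assert (H1 := hyper_coef_S P Q K j HK).
    assert (H2 := hyper_coef_S (K - P) (K - Q) K j HK).
    assert (H3 : binom_coef (K - P - Q) 0 = 1) by (unfold binom_coef; simpl; cfield).
    rewrite H3 in *.
    assert (H4 : (K + INR j) * (INR j + 1) <> 0).
    { apply Cmult_neq_0; [|apply S_C_neq_0]. intros H. apply HK. exists j.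
      rewrite RtoC_opp. replace K with (K + INR j - INR j) by cring. rewrite H. cring. }
    (* The recurrence in j can be divided out, as its leading factor is nonzero. *)
    apply (Cmult_reg_l _ _ _ H4).
    rewrite H2.
    match type of E with ?A * ?S - _ = _ => set (Z := S) in * end.
    match goal with |- _ * (?S + _) = _ => change S with Z end.
    transitivity ((K + INR j) * (INR j + 1) * Z
                  + (K + INR j) * (INR j + 1) * hyper_coef P Q K (S j)).
    { cring. }
    rewrite H1.
    match type of E with ?A - ?B = ?D => replace A with (A - B + B) by cring; rewrite E end.
    cring.
Qed.

(** The coefficient of w^k in p^s, where p = 1 + w p^2, p(0) = 1; for s = 1 these are
    the Catalan numbers.  It equals s (s)_(2k) / ((s)_(k+1) k!), written so as to be
    visibly a polynomial in s. *)
Definition catalan_coef (s : C) (k : nat) : C :=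
  match k with
  | O => 1
  | S m => s * pochhammer (s + INR k + 1) m / INR (fact k)
  end.

Lemma pochhammer_duplication (b : C) (k : nat) :
  pochhammer (2 * b) (2 * k) = 4 ^ k * (pochhammer b k * pochhammer (b + 1 / 2) k).
Proof.
  induction k as [|k IH].
  - simpl. ring.
  - replace (2 * S k)%nat with (S (S (2 * k))) by lia.
    change (pochhammer (2 * b) (S (S (2 * k)))) with
      (pochhammer (2 * b) (2 * k) * (2 * b + INR (2 * k)) * (2 * b + INR (S (2 * k)))).
    rewrite IH, S_INR, mult_INR, !RtoC_plus, RtoC_mult.
    change (INR 2) with 2%R. simpl. field.
Qed.

(** With w = y/4 this is p^(2b) = F(b, b + 1/2; 2b + 1; y), by the duplication
    formula. *)
Lemma catalan_coef_hyper_coef (b : C) (k : nat) : ~ nonpos_integer (2 * b + 1) ->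
  catalan_coef (2 * b) k / 4 ^ k = hyper_coef b (b + 1 / 2) (2 * b + 1) k.
Proof.
  intros Hb. destruct k as [|m].
  - unfold hyper_coef. simpl. field.
  - unfold hyper_coef, catalan_coef. assert (H4 : (4 : C) ^ S m <> 0).
    { apply Cpow_nz. intros H. apply RtoC_inj in H. lra. }
    replace (pochhammer b (S m) * pochhammer (b + 1 / 2) (S m))
      with (pochhammer (2 * b) (2 * S m) / 4 ^ S m)
      by (rewrite pochhammer_duplication; field; exact H4).
    replace (2 * S m)%nat with (S (S m + m)) by lia.
    rewrite pochhammer_head, pochhammer_add.
    replace (2 * b + 1 + INR (S m)) with (2 * b + INR (S m) + 1) by ring.
    field. repeat split; auto using pochhammer_neq_0, fact_C_neq_0.
Qed.

(** Continuity is only used along a real perturbation of a complex parameter, for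
    which a function of one real variable is enough. *)
Definition cont_at_0 (f : R -> C) : Prop :=
  @continuous R_UniformSpace (AbsRing_UniformSpace C_AbsRing) f 0%R.

Lemma cont_at_0_const (z : C) : cont_at_0 (fun _ => z).
Proof. apply continuous_const. Qed.

Lemma cont_at_0_ext (f g : R -> C) : (forall e, f e = g e) -> cont_at_0 f -> cont_at_0 g.
Proof.
  apply (@continuous_ext R_UniformSpace (AbsRing_UniformSpace C_AbsRing)).
Qed.

Lemma cont_at_0_plus (f g : R -> C) :
  cont_at_0 f -> cont_at_0 g -> cont_at_0 (fun e => f e + g e).
Proof. apply (@continuous_plus R_UniformSpace C_AbsRing (AbsRing_NormedModule C_AbsRing)). Qed.

Lemma cont_at_0_mult (f g : R -> C) :
  cont_at_0 f -> cont_at_0 g -> cont_at_0 (fun e => f e * g e).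
Proof. apply (@continuous_mult R_UniformSpace C_AbsRing). Qed.

Lemma cont_at_0_RtoC : cont_at_0 RtoC.
Proof.
  intros P [eps HP]. exists eps. intros y Hy. apply HP.
  change (Cmod (RtoC y - RtoC 0) < eps)%R. rewrite <- RtoC_minus, Cmod_R.
  exact Hy.
Qed.

Lemma cont_at_0_pochhammer (f : R -> C) (n : nat) :
  cont_at_0 f -> cont_at_0 (fun e => pochhammer (f e) n).
Proof.
  intros Hf. induction n as [|n IH]; simpl.
  - apply cont_at_0_const.
  - apply cont_at_0_mult; [exact IH|].
    apply cont_at_0_plus; [exact Hf | apply cont_at_0_const].
Qed.

Lemma cont_at_0_sum (f : nat -> R -> C) (n : nat) :
  (forall k, cont_at_0 (f k)) -> cont_at_0 (fun e => sum_n (fun k => f k e) n).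
Proof.
  intros Hf. induction n as [|n IH].
  - apply cont_at_0_ext with (f 0%nat); [|apply Hf].
    intros e. now rewrite sumC_O.
  - apply cont_at_0_ext with (fun e => sum_n (fun k => f k e) n + f (S n) e).
    + intros e. now rewrite sumC_S.
    + now apply cont_at_0_plus.
Qed.

Lemma cont_at_0_eq (f g : R -> C) (d : R) : (0 < d)%R -> cont_at_0 f -> cont_at_0 g ->
  (forall e, (0 < e < d)%R -> f e = g e) -> f 0%R = g 0%R.
Proof.
  intros Hd Hf Hg H.
  assert (Hm : cont_at_0 (fun e => f e + -1 * g e)).
  { apply cont_at_0_plus; [exact Hf|].
    apply cont_at_0_mult; [apply cont_at_0_const | exact Hg]. }
  apply Ceq_minus. apply Cmod_eq_0.
  destruct (Rle_lt_or_eq_dec 0 _ (Cmod_ge_0 (f 0%R - g 0%R))) as [Hp|Hp]; [|now symmetry].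
  destruct (Hm (fun z => Cmod (z - (f 0%R + -1 * g 0%R)) < Cmod (f 0%R - g 0%R))%R)
    as [eps He].
  { exists (mkposreal _ Hp). intros z Hz. exact Hz. }
  exfalso. destruct eps as [eps Heps]. simpl in He.
  set (e := (Rmin eps d / 2)%R).
  assert (He0 : (0 < e < d /\ e < eps)%R).
  { unfold e. assert (H1 := Rmin_l eps d). assert (H2 := Rmin_r eps d).
    assert (H3 := Rmin_glb_lt eps d 0 Heps Hd). lra. }
  specialize (He e). rewrite (H e) in He by tauto.
  apply (Rlt_irrefl (Cmod (f 0%R - g 0%R))).
  replace (Cmod (f 0%R - g 0%R)) with (Cmod (g e + -1 * g e - (f 0%R + -1 * g 0%R))) at 1.
  - apply He. change (Rabs (e - 0) < eps)%R. rewrite Rabs_pos_eq; lra.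
  - rewrite <- Cmod_opp. apply f_equal. cring.
Qed.

(** Euler's transformation for P = a, Q = b + 1/2, K = 2b + 1, multiplied by (b)_j.
    This clears the denominators (2b+1)_i and (b)_i, so that both sides are
    polynomials in b. *)
Definition euler_identity (a b : C) (j : nat) : Prop :=
  sum_n (fun i => binom_coef (b + 1 / 2 - a) (j - i) *
     (pochhammer a i * pochhammer (b + INR i) (j - i) * (catalan_coef (2 * b) i / 4 ^ i))) j
  = pochhammer (2 * b + 1 - a) j * (catalan_coef (2 * b) j / 4 ^ j).

Lemma euler_identity_generic (a b : C) (j : nat) :
  ~ nonpos_integer (2 * b + 1) -> euler_identity a b j.
Proof.
  intros Hb. unfold euler_identity.
  rewrite catalan_coef_hyper_coef by exact Hb.
  rewrite (sum_n_ext_loc _ (fun i => pochhammer b j *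
     (binom_coef (2 * b + 1 - a - (b + 1 / 2)) (j - i) * hyper_coef a (b + 1 / 2) (2 * b + 1) i))).
  - rewrite sumC_mult, euler_coef by exact Hb. unfold hyper_coef.
    replace (2 * b + 1 - (b + 1 / 2)) with (b + 1 / 2) by field.
    at_C. unfold Cdiv. ring.
  - intros i Hi. rewrite catalan_coef_hyper_coef by exact Hb.
    replace (2 * b + 1 - a - (b + 1 / 2)) with (b + 1 / 2 - a) by field.
    replace (pochhammer b j) with (pochhammer b i * pochhammer (b + INR i) (j - i)).
    + unfold hyper_coef, Cdiv. cring.
    + rewrite <- pochhammer_add. f_equal. lia.
Qed.

(** Nonpositive integers are at distance at least 1 from one another. *)
Lemma nonpos_integer_perturb (q : C) (e : R) : nonpos_integer q -> (0 < e < 1)%R ->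
  ~ nonpos_integer (q + e).
Proof.
  intros [n Hn] He [m Hm]. rewrite Hn, <- RtoC_plus in Hm. apply RtoC_inj in Hm.
  assert (H1 : (INR m < INR n)%R) by lra. apply INR_lt in H1.
  assert (H2 := le_INR (S m) n H1). rewrite S_INR in H2. lra.
Qed.

(** When 2b + 1 is a nonpositive integer, 2(b+e) + 1 is not for small e > 0, and
    both sides are continuous at e = 0. *)
Lemma euler_identity_all (a b : C) (j : nat) : euler_identity a b j.
Proof.
  destruct (excluded_middle_informative (nonpos_integer (2 * b + 1)))
    as [Hb|Hb]; [|now apply euler_identity_generic].
  assert (Hlin : forall u v : C, cont_at_0 (fun e : R => u * (b + e) + v)).
  { intros u v. apply cont_at_0_plus; [|apply cont_at_0_const].
    apply cont_at_0_mult; [apply cont_at_0_const|].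
    apply cont_at_0_plus; [apply cont_at_0_const | apply cont_at_0_RtoC]. }
  assert (Hg : forall k, cont_at_0 (fun e : R => catalan_coef (2 * (b + e)) k / 4 ^ k)).
  { intros [|m]; [apply cont_at_0_const|]. unfold catalan_coef, Cdiv.
    apply cont_at_0_mult; [|apply cont_at_0_const].
    apply cont_at_0_mult; [|apply cont_at_0_const].
    apply cont_at_0_mult.
    - apply cont_at_0_mult; [apply cont_at_0_const|].
      apply cont_at_0_plus; [apply cont_at_0_const | apply cont_at_0_RtoC].
    - apply cont_at_0_pochhammer.
      refine (cont_at_0_ext _ _ _ (Hlin 2 (INR (S m) + 1))).
      intros e. cring. }
  assert (Hp : forall u v w n, (forall e : R, w e = u * (b + e) + v) ->
            cont_at_0 (fun e => pochhammer (w e) n)).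
  { intros u v w n Hw. apply cont_at_0_pochhammer.
    refine (cont_at_0_ext _ _ _ (Hlin u v)). intros e. now rewrite Hw. }
  unfold euler_identity.
  assert (E := cont_at_0_eq
    (fun e : R => sum_n (fun i => binom_coef (b + e + 1 / 2 - a) (j - i) *
       (pochhammer a i * pochhammer (b + e + INR i) (j - i)
          * (catalan_coef (2 * (b + e)) i / 4 ^ i))) j)
    (fun e : R => pochhammer (2 * (b + e) + 1 - a) j * (catalan_coef (2 * (b + e)) j / 4 ^ j))
    (1 / 2)).
  cbv beta in E. rewrite Cplus_0_r in E. apply E; clear E.
  - lra.
  - apply cont_at_0_sum. intros i. apply cont_at_0_mult.
    + unfold binom_coef, Cdiv. apply cont_at_0_mult; [|apply cont_at_0_const].
      apply (Hp 1 (1 * / 2 - a)). intros e. cring.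
    + apply cont_at_0_mult; [|apply Hg]. apply cont_at_0_mult; [apply cont_at_0_const|].
      apply (Hp 1 (RtoC (INR i))). intros e. cring.
  - apply cont_at_0_mult; [|apply Hg]. apply (Hp 2 (1 - a)). intros e. cring.
  - intros e He. apply euler_identity_generic.
    replace (2 * (b + e) + 1) with (2 * b + 1 + RtoC (2 * e)%R)
      by (rewrite RtoC_mult; ring).
    apply nonpos_integer_perturb; [exact Hb | lra].
Qed.
(** * Powers of 1 - x as series in y: the finite identity *)

(** The N-th difference of [f] at 0, divided by N! and up to the sign (-1)^N; the
    division makes the binomial coefficients products of factorials. *)
Definition finite_difference (f : nat -> C) (N : nat) : C :=
  sum_n (fun k => (-1) ^ k / (INR (fact k) * INR (fact (N - k))) * f k) N.

(** Pascal's rule, from N + 1 = (N + 1 - k) + k. *)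
Lemma finite_difference_S (f : nat -> C) (N : nat) :
  (INR N + 1) * finite_difference f (S N) = finite_difference (fun k => f k - f (S k)) N.
Proof.
  unfold finite_difference. rewrite <- sumC_mult.
  rewrite (sum_n_ext_loc _ (fun k =>
     (INR (S N) - INR k) * ((-1) ^ k / (INR (fact k) * INR (fact (S N - k))) * f k)
     + INR k * ((-1) ^ k / (INR (fact k) * INR (fact (S N - k))) * f k))).
  2:{ intros k Hk. rewrite S_INR, RtoC_plus. cring. }
  rewrite sumC_plus. rewrite sumC_S, (sumC_first (fun k => INR k * _)).
  rewrite (sum_n_ext_loc _ (fun k => (-1) ^ k / (INR (fact k) * INR (fact (N - k))) * f k)).
  2:{ intros k Hk. replace (S N - k)%nat with (S (N - k)) by lia.
      rewrite fact_C_S, minus_INR, RtoC_minus, S_INR, RtoC_plus by lia.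
      assert (H := S_C_neq_0 (N - k)). rewrite minus_INR, RtoC_minus in H by lia.
      cfield. repeat split; auto using fact_C_neq_0.
       }
  rewrite (sum_n_ext (fun k => INR (S k) * _)
    (fun k => (-1) * ((-1) ^ k / (INR (fact k) * INR (fact (N - k))) * f (S k)))).
  2:{ intros k. rewrite fact_C_S, S_INR, RtoC_plus. simpl Nat.sub. simpl Cpow.
      assert (H := S_C_neq_0 k).
      cfield. repeat split; auto using fact_C_neq_0. }
  rewrite sumC_mult.
  rewrite (sum_n_ext (fun k => _ * (f k - f (S k))) (fun k =>
     (-1) ^ k / (INR (fact k) * INR (fact (N - k))) * f k -
     (-1) ^ k / (INR (fact k) * INR (fact (N - k))) * f (S k))) by (intros; cring).
  rewrite sumC_minus. simpl (INR 0). cring.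
Qed.

Lemma finite_difference_scal (z : C) (f : nat -> C) (N : nat) :
  finite_difference (fun k => z * f k) N = z * finite_difference f N.
Proof.
  unfold finite_difference. rewrite <- sumC_mult. apply sum_n_ext. intros k. cring.
Qed.

Lemma finite_difference_ext (f g : nat -> C) (N : nat) :
  (forall k, f k = g k) -> finite_difference f N = finite_difference g N.
Proof. intros H. apply sum_n_ext. intros k. now rewrite H. Qed.

(** In [q] the Pochhammer symbol (q)_M is a polynomial of degree M, and each difference
    lowers M by 1: (q)_M - (q+1)_M = - M (q+1)_(M-1). *)
Lemma finite_difference_pochhammer (M N : nat) (q : C) : (M < N)%nat ->
  finite_difference (fun k => pochhammer (q + INR k) M) N = 0.
Proof.
  revert N q. induction M as [|M IH]; intros N q HMN; (destruct N as [|N]; [lia|]).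
  - assert (E := finite_difference_S (fun k => pochhammer (q + INR k) 0) N).
    rewrite (finite_difference_ext (fun k => _ - _) (fun k => 0 * 0)) in E
      by (intros; change (1 - 1 = 0 * 0); ring).
    rewrite finite_difference_scal, Cmult_0_l in E.
    apply (Cmult_reg_l _ _ _ (S_C_neq_0 N)). rewrite E. cring.
  - assert (E := finite_difference_S (fun k => pochhammer (q + INR k) (S M)) N).
    rewrite (finite_difference_ext (fun k => _ - _)
      (fun k => - (INR M + 1) * pochhammer (q + 1 + INR k) M)) in E.
    + rewrite finite_difference_scal, IH, Cmult_0_r in E by lia.
      apply (Cmult_reg_l _ _ _ (S_C_neq_0 N)). rewrite E. cring.
    + intros k. rewrite pochhammer_head.
      change (pochhammer (q + INR (S k)) (S M)) with
        (pochhammer (q + INR (S k)) M * (q + INR (S k) + INR M)).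
      rewrite S_INR, RtoC_plus.
      replace (q + (INR k + 1)) with (q + INR k + 1) by ring.
      replace (q + 1 + INR k) with (q + INR k + 1) by ring.
      ring.
Qed.

(** The coefficient of x^N in sum_k catalan_coef s k (-x)^k (1-x)^(-2k-s), which is
    p^s (1-x)^(-s) for w = -x/(1-x)^2.  The two Pochhammer symbols in the k-th term
    join into (s+k+1)_(N-1), so for N > 0 the sum is s times an N-th difference of a
    polynomial in k of degree N - 1. *)
Lemma catalan_coef_binom_sum (s : C) (N : nat) :
  sum_n (fun k => (-1) ^ k * catalan_coef s k * binom_coef (2 * INR k + s) (N - k)) N
  = match N return C with O => 1 | _ => 0 end.
Proof.
  destruct N as [|N].
  - rewrite sumC_O. unfold binom_coef. simpl. field.
  - rewrite (sum_n_ext_loc _ (fun k => s * ((-1) ^ k / (INR (fact k) * INR (fact (S N - k)))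
        * pochhammer (s + 1 + INR k) N))).
    + rewrite sumC_mult.
      change (s * finite_difference (fun k => pochhammer (s + 1 + INR k) N) (S N) = 0).
      rewrite finite_difference_pochhammer by lia. ring.
    + intros [|m] Hk; unfold binom_coef.
      * replace (2 * INR 0 + s) with s by (simpl; ring). simpl Nat.sub.
        rewrite pochhammer_head. simpl INR.
        replace (s + 1 + 0) with (s + 1) by ring.
        assert (H := fact_C_neq_0 (S N)). simpl catalan_coef. simpl (fact 0).
        simpl (INR 1). simpl Cpow. cfield. exact H.
      * unfold catalan_coef.
        assert (E : pochhammer (s + 1 + INR (S m)) N
          = pochhammer (s + 1 + INR (S m)) m
            * pochhammer (2 * INR (S m) + s) (S N - S m)).
        { replace (2 * INR (S m) + s) with (s + 1 + INR (S m) + INR m)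
            by (rewrite S_INR, RtoC_plus; ring).
          rewrite <- pochhammer_add. f_equal. lia. }
        rewrite E.
        replace (s + INR (S m) + 1) with (s + 1 + INR (S m)) by ring.
        cfield. split; apply fact_C_neq_0.
Qed.

(** * The right-hand operator on coefficients in y *)

(** The coefficients in powers of y of (1-x)^(2b) sum_n v_n x^n, collected from
    x^n (1-x)^(2b) = (-y/4)^n p^(2(b+n)) with p = 1 - x. *)
Definition y_coef (b : C) (v : nat -> C) (k : nat) : C :=
  sum_n (fun n => v n * (-1 / 4) ^ n
                  * (catalan_coef (2 * (b + INR n)) (k - n) / 4 ^ (k - n))) k.

(** The theorem on coefficients: in the coordinate y, the right-hand operator
    multiplies each v_n by (a)_n / (c)_n.  Exchanging the sums leaves, for each n, the
    sum in [euler_identity] with the parameters a and b shifted by n, under which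
    (c - a)/2 does not change. *)
Lemma y_coef_hypergeometrization (a c : C) (v : nat -> C) (k : nat) :
  let b := (a + c - 1) / 2 in
  ~ nonpos_integer c -> ~ nonpos_integer b ->
  sum_n (fun i => binom_coef ((c - a) / 2) (k - i)
                  * (y_coef b v i * (pochhammer a i / pochhammer b i))) k
    * (pochhammer b k / pochhammer c k)
  = y_coef b (fun n => v n * (pochhammer a n / pochhammer c n)) k.
Proof.
  intros b Hc Hb.
  rewrite (sum_n_ext_loc _ (fun i => sum_n (fun n =>
    (fun n m => binom_coef ((c - a) / 2) (k - (n + m)) *
       (v n * (-1 / 4) ^ n * (catalan_coef (2 * (b + INR n)) m / 4 ^ m)
        * (pochhammer a (n + m) / pochhammer b (n + m)))) n (i - n)%nat) i)).
  2:{ intros i Hi. unfold y_coef.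
      transitivity (sum_n (fun n => (binom_coef ((c - a) / 2) (k - i)
        * (pochhammer a i / pochhammer b i)) * (v n * (-1 / 4) ^ n
                  * (catalan_coef (2 * (b + INR n)) (i - n) / 4 ^ (i - n)))) i).
      - rewrite sumC_mult. cring.
      - apply sum_n_ext_loc. intros n Hn. cbv beta.
        replace (n + (i - n))%nat with i by lia. cring. }
  rewrite (sum_triangle (fun n m => binom_coef ((c - a) / 2) (k - (n + m)) *
       (v n * (-1 / 4) ^ n * (catalan_coef (2 * (b + INR n)) m / 4 ^ m)
        * (pochhammer a (n + m) / pochhammer b (n + m))))).
  rewrite Cmult_comm. unfold y_coef. rewrite <- sumC_mult.
  apply sum_n_ext_loc. intros n Hn.
  set (j := (k - n)%nat).
  assert (E := euler_identity_all (a + INR n) (b + INR n) j). unfold euler_identity in E.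
  assert (Hbn := pochhammer_neq_0 b n Hb).
  assert (Hcn := pochhammer_neq_0 c n Hc).
  assert (Hbj := pochhammer_neq_0 (b + INR n) j (nonpos_integer_shift b n Hb)).
  assert (Hcj := pochhammer_neq_0 (c + INR n) j (nonpos_integer_shift c n Hc)).
  replace (b + INR n + 1 / 2 - (a + INR n)) with ((c - a) / 2) in E by (unfold b; field).
  replace (2 * (b + INR n) + 1 - (a + INR n)) with (c + INR n) in E by (unfold b; field).
  rewrite (sum_n_ext_loc _ (fun m =>
    (v n * (-1 / 4) ^ n * (pochhammer a n / pochhammer b n) / pochhammer (b + INR n) j) *
    (binom_coef ((c - a) / 2) (j - m) *
      (pochhammer (a + INR n) m * pochhammer (b + INR n + INR m) (j - m) *
       (catalan_coef (2 * (b + INR n)) m / 4 ^ m))))).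
  - rewrite sumC_mult, E.
    replace k with (n + j)%nat by (unfold j; lia). rewrite !pochhammer_add.
    cfield. repeat split; auto. apply Cpow_nz. intros H. apply RtoC_inj in H. lra.
  - intros m Hm. replace (k - (n + m))%nat with (j - m)%nat by (unfold j; lia).
    assert (E2 : pochhammer (b + INR n) j = pochhammer (b + INR n) m
       * pochhammer (b + INR n + INR m) (j - m)).
    { rewrite <- pochhammer_add. f_equal. lia. }
    assert (H1 := pochhammer_neq_0 (b + INR n) m (nonpos_integer_shift b n Hb)).
    assert (H2 := pochhammer_neq_0 (b + INR n + INR m) (j - m)
       (nonpos_integer_shift _ m (nonpos_integer_shift b n Hb))).
    rewrite E2, !pochhammer_add. cfield.
    repeat split; auto. apply Cpow_nz. intros H. apply RtoC_inj in H. lra.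
Qed.

(** * Complex power series *)

Lemma minus_0 (x : C) : minus x (0 : C) = x.
Proof. change (x - 0 = x). ring. Qed.

Lemma locally_C0 (P : C -> Prop) :
  locally (0 : C) P <-> exists d, (0 < d)%R /\ forall x, (Cmod x < d)%R -> P x.
Proof.
  split.
  - intros [eps H]. exists eps. split; [apply cond_pos|]. intros x Hx. apply H.
    apply C_NormedModule_mixin_compat1.
    now rewrite minus_0.
  - intros [d [Hd H]].
    assert (H2 : (0 < sqrt 2)%R) by (apply sqrt_lt_R0; lra).
    assert (Hp : (0 < d / sqrt 2)%R) by (apply Rdiv_lt_0_compat; lra).
    exists (mkposreal _ Hp). intros x Hx. apply H.
    apply C_NormedModule_mixin_compat2 in Hx. simpl in Hx.
    rewrite minus_0 in Hx.
    replace (sqrt 2 * (d / sqrt 2))%R with d in Hx by (field; lra). exact Hx.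
Qed.

Lemma is_series_C (u : nat -> C) (l : C) :
  @is_series C_AbsRing C_NormedModule u l <->
  forall eps, (0 < eps)%R -> exists N, forall n, (N <= n)%nat ->
    (Cmod (sum_n u n - l) < eps)%R.
Proof.
  unfold is_series. split.
  - intros H eps Heps.
    apply (filterlim_locally_ball_norm (K := C_AbsRing) (U := C_NormedModule)) with
      (eps := mkposreal _ Heps) in H. exact H.
  - intros H. apply (filterlim_locally_ball_norm (K := C_AbsRing) (U := C_NormedModule)).
    intros [eps Heps]. exact (H eps Heps).
Qed.

Definition partial_sum (u : nat -> C) (x : C) (n : nat) : C :=
  sum_n (fun k => u k * x ^ k) n.

(** [is_pseries] on complex numbers, with arguments typed in [C] so that complex
    arithmetic can be written in them. *)
Definition is_pser (u : nat -> C) (x l : C) : Prop :=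
  @is_pseries C_AbsRing C_NormedModule u x l.

Lemma is_pser_series (u : nat -> C) (x l : C) :
  is_pser u x l <-> @is_series C_AbsRing C_NormedModule (fun k => u k * x ^ k) l.
Proof.
  unfold is_pser, is_pseries. split; apply is_series_ext; intros n; apply Cmult_comm.
Qed.

Lemma is_pser_eps (u : nat -> C) (x l : C) :
  is_pser u x l <->
  forall eps, (0 < eps)%R -> exists N, forall n, (N <= n)%nat ->
    (Cmod (partial_sum u x n - l) < eps)%R.
Proof. now rewrite is_pser_series, is_series_C. Qed.

Lemma is_pser_unique (u : nat -> C) (x l l' : C) :
  is_pser u x l -> is_pser u x l' -> l = l'.
Proof.
  intros H H'.
  exact (filterlim_locally_unique (K := C_AbsRing) (V := C_NormedModule) _ l l' H H').
Qed.

Lemma is_pser_ext (u w : nat -> C) (x l : C) :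
  (forall n, u n = w n) -> is_pser u x l -> is_pser w x l.
Proof. exact (@is_pseries_ext C_AbsRing C_NormedModule u w x l). Qed.

Lemma is_pser_mult (z : C) (u : nat -> C) (x l : C) :
  is_pser u x l -> is_pser (fun n => z * u n) x (z * l).
Proof.
  rewrite !is_pser_series. intros H.
  apply is_series_ext with (fun n => scal z (u n * x ^ n)).
  - intros n. apply Cmult_assoc.
  - exact (is_series_scal z _ _ H).
Qed.

Lemma is_pser_minus (u w : nat -> C) (x l l' : C) :
  is_pser u x l -> is_pser w x l' -> is_pser (fun n => u n - w n) x (l - l').
Proof. exact (@is_pseries_minus C_AbsRing C_NormedModule u w x l l'). Qed.

Lemma Cmod_sum (f : nat -> C) (g : nat -> R) (n : nat) :
  (forall k, (k <= n)%nat -> (Cmod (f k) <= g k)%R) ->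
  (Cmod (sum_n f n) <= sum_n g n)%R.
Proof.
  induction n as [|n IH]; intros H.
  - rewrite !sum_O. now apply H.
  - rewrite sumC_S, sum_Sn. apply Rle_trans with (1 := Cmod_triangle _ _).
    apply Rplus_le_compat; [apply IH; intros; apply H; lia | now apply H].
Qed.

(** A sequence is the sequence of coefficients of an analytic germ if and only if it
    has such a bound, and the bound passes easily through products and rearrangements;
    it replaces the radius of convergence throughout. *)
Definition geom_bound (K q : R) (u : nat -> C) : Prop :=
  (0 <= K /\ 0 <= q /\ forall n, Cmod (u n) <= K * q ^ n)%R.

(** The factor 1 - r^p makes the induction on [p] go through: for r <= 1/2 the next
    term is at most K r^(N+1) r^p, and 1 <= 2 (1 - r). *)
Lemma partial_sum_increment (K q : R) (u : nat -> C) (x : C) (N p : nat) :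
  geom_bound K q u -> (Cmod x * q <= 1 / 2)%R ->
  (Cmod (partial_sum u x (N + p) - partial_sum u x N)
   <= 2 * K * (Cmod x * q) ^ S N * (1 - (Cmod x * q) ^ p))%R.
Proof.
  intros [HK [Hq Hu]] Hx.
  assert (Hr : (0 <= Cmod x * q)%R) by (apply Rmult_le_pos; [apply Cmod_ge_0 | exact Hq]).
  induction p as [|p IH].
  - rewrite Nat.add_0_r. replace (partial_sum u x N - partial_sum u x N) with (0 : C) by ring.
    rewrite Cmod_0. simpl. lra.
  - rewrite Nat.add_succ_r. unfold partial_sum at 1. rewrite sumC_S. fold (partial_sum u x (N + p)).
    replace (partial_sum u x (N + p) + u (S (N + p)) * x ^ S (N + p) - partial_sum u x N)
      with (partial_sum u x (N + p) - partial_sum u x N + u (S (N + p)) * x ^ S (N + p)) by ring.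
    apply Rle_trans with (1 := Cmod_triangle _ _).
    apply Rle_trans with (1 := Rplus_le_compat_r _ _ _ IH).
    assert (Ht : (Cmod (u (S (N + p)) * x ^ S (N + p))
                  <= K * (Cmod x * q) ^ S N * (Cmod x * q) ^ p)%R).
    { rewrite Cmod_mult, Cmod_pow.
      apply Rle_trans with (K * q ^ S (N + p) * Cmod x ^ S (N + p))%R.
      - apply Rmult_le_compat_r; [apply pow_le, Cmod_ge_0 | apply Hu].
      - right. change (S (N + p)) with (S N + p)%nat.
        rewrite !Rpow_mult_distr, !pow_add. ring. }
    set (t := ((Cmod x * q) ^ p)%R) in *. set (s := ((Cmod x * q) ^ S N)%R) in *.
    assert (H0 : (0 <= K * s * t)%R)
      by (apply Rmult_le_pos; [apply Rmult_le_pos; [exact HK|]|]; now apply pow_le).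
    replace ((Cmod x * q) ^ S p)%R with (Cmod x * q * t)%R by reflexivity.
    set (r := (Cmod x * q)%R) in *.
    assert (H1 := Rmult_le_compat_r (K * s * t) _ _ H0 Hx). lra.
Qed.

Lemma pser_tail (K q : R) (u : nat -> C) (x l : C) (N : nat) :
  geom_bound K q u -> (Cmod x * q <= 1 / 2)%R -> is_pser u x l ->
  (Cmod (l - partial_sum u x N) <= 2 * K * (Cmod x * q) ^ S N)%R.
Proof.
  intros Hu Hx Hl. apply le_epsilon. intros eps Heps.
  destruct (proj1 (is_pser_eps u x l) Hl eps Heps) as [M HM].
  specialize (HM (N + M)%nat ltac:(lia)).
  assert (Hi := partial_sum_increment K q u x N M Hu Hx). destruct Hu as [HK [Hq Hu]].
  replace (l - partial_sum u x N) with
    (partial_sum u x (N + M) - partial_sum u x N + - (partial_sum u x (N + M) - l)) by ring.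
  apply Rle_trans with (1 := Cmod_triangle _ _). rewrite Cmod_opp.
  assert (Hr : (0 <= Cmod x * q)%R) by (apply Rmult_le_pos; [apply Cmod_ge_0 | exact Hq]).
  assert (H1 : (0 <= 2 * K * (Cmod x * q) ^ S N * (Cmod x * q) ^ M)%R).
  { apply Rmult_le_pos; [apply Rmult_le_pos; [lra|]|]; now apply pow_le. }
  lra.
Qed.

Lemma Re_sum (u : nat -> C) (n : nat) : Re (sum_n u n) = sum_n (fun k => Re (u k)) n.
Proof.
  induction n as [|n IH].
  - now rewrite !sum_O.
  - rewrite sumC_S, sum_Sn, <- IH. reflexivity.
Qed.

Lemma Im_sum (u : nat -> C) (n : nat) : Im (sum_n u n) = sum_n (fun k => Im (u k)) n.
Proof.
  induction n as [|n IH].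
  - now rewrite !sum_O.
  - rewrite sumC_S, sum_Sn, <- IH. reflexivity.
Qed.

Lemma im_le_Cmod (z : C) : (Rabs (Im z) <= Cmod z)%R.
Proof. apply Rle_trans with (2 := Rmax_Cmod z). apply Rmax_r. Qed.

Lemma Cmod_le_Re_Im (z : C) : (Cmod z <= Rabs (Re z) + Rabs (Im z))%R.
Proof.
  replace z with (RtoC (Re z) + Ci * RtoC (Im z)) at 1.
  - apply Rle_trans with (1 := Cmod_triangle _ _).
    rewrite Cmod_mult, !Cmod_R, Cmod_Ci. lra.
  - destruct z as [p q]. unfold Ci, RtoC, Cplus, Cmult. simpl. f_equal; ring.
Qed.

Lemma is_series_R_eps (u : nat -> R) (l : R) :
  is_series u l <-> forall eps, (0 < eps)%R -> exists N, forall n, (N <= n)%nat ->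
    (Rabs (sum_n u n - l) < eps)%R.
Proof.
  unfold is_series. split.
  - intros H eps Heps. apply (filterlim_locally (sum_n u)) with
      (eps := mkposreal _ Heps) in H. exact H.
  - intros H. apply (filterlim_locally (sum_n u)). intros [eps Heps]. exact (H eps Heps).
Qed.

Lemma is_series_Re_Im (u : nat -> C) (l : C) :
  @is_series C_AbsRing C_NormedModule u l <->
  is_series (fun k => Re (u k)) (Re l) /\ is_series (fun k => Im (u k)) (Im l).
Proof.
  rewrite is_series_C, !is_series_R_eps. split.
  - intros H. split; intros eps Heps; destruct (H eps Heps) as [N HN]; exists N;
      intros n Hn; specialize (HN n Hn); apply Rle_lt_trans with (2 := HN).
    + rewrite <- Re_sum. exact (re_le_Cmod (sum_n u n - l)).
    + rewrite <- Im_sum. exact (im_le_Cmod (sum_n u n - l)).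
  - intros [H1 H2] eps Heps.
    destruct (H1 (eps / 2)%R ltac:(lra)) as [N1 HN1].
    destruct (H2 (eps / 2)%R ltac:(lra)) as [N2 HN2].
    exists (max N1 N2). intros n Hn.
    specialize (HN1 n ltac:(lia)). specialize (HN2 n ltac:(lia)).
    rewrite <- Re_sum in HN1. rewrite <- Im_sum in HN2.
    apply Rle_lt_trans with (1 := Cmod_le_Re_Im _).
    change (Re (sum_n u n - l)) with (Re (sum_n u n) - Re l)%R.
    change (Im (sum_n u n - l)) with (Im (sum_n u n) - Im l)%R. lra.
Qed.

(** The sum is given by its real and imaginary parts because completeness is used
    for real series. *)
Lemma geom_bound_cv (K q : R) (u : nat -> C) (x : C) :
  geom_bound K q u -> (Cmod x * q <= 1 / 2)%R ->
  is_pser u x (Series (fun k => Re (u k * x ^ k)), Series (fun k => Im (u k * x ^ k))).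
Proof.
  intros [HK [Hq Hu]] Hx. rewrite is_pser_series, is_series_Re_Im.
  assert (Hr : (0 <= Cmod x * q)%R) by (apply Rmult_le_pos; [apply Cmod_ge_0 | exact Hq]).
  assert (Hg : ex_series (fun k => K * (Cmod x * q) ^ k)%R).
  { apply (@ex_series_scal R_AbsRing R_NormedModule K (fun k => (Cmod x * q) ^ k)%R).
    exists (/ (1 - Cmod x * q))%R. apply is_series_geom.
    rewrite Rabs_pos_eq; lra. }
  assert (Hb : forall k, (Cmod (u k * x ^ k) <= K * (Cmod x * q) ^ k)%R).
  { intros k. rewrite Cmod_mult, Cmod_pow, Rpow_mult_distr, (Rmult_comm (Cmod x ^ k)),
      <- Rmult_assoc.
    apply Rmult_le_compat_r; [apply pow_le, Cmod_ge_0 | apply Hu]. }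
  split; apply Series_correct; refine (ex_series_le _ _ _ Hg); intros k;
    refine (Rle_trans _ _ _ _ (Hb k)); [apply re_le_Cmod | apply im_le_Cmod].
Qed.

Lemma INR_S_le_pow_2 (n : nat) : (INR (S n) <= 2 ^ n)%R.
Proof.
  induction n as [|n IH]; [simpl; lra|]. rewrite S_INR. simpl (2 ^ S n)%R.
  assert (H := pow_R1_Rle 2 n ltac:(lra)). lra.
Qed.

(** A diagonal has N + 1 <= 2^N terms, whence the factor 2. *)
Lemma geom_bound_diagonals (K q : R) (a : nat -> nat -> C) : (0 <= K)%R -> (0 <= q)%R ->
  (forall k m, (Cmod (a k m) <= K * q ^ k * q ^ m)%R) ->
  geom_bound K (2 * q) (fun N => sum_n (fun k => a k (N - k)%nat) N).
Proof.
  intros HK Hq Ha. repeat split; [exact HK | lra |]. intros N.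
  apply Rle_trans with (sum_n (fun _ : nat => K * q ^ N)%R N).
  - apply Cmod_sum. intros k Hk. apply Rle_trans with (1 := Ha _ _).
    rewrite Rmult_assoc, <- pow_add. replace (k + (N - k))%nat with N by lia. lra.
  - rewrite sum_n_const, Rpow_mult_distr.
    assert (H1 : (0 <= q ^ N)%R) by now apply pow_le.
    assert (H2 := INR_S_le_pow_2 N).
    assert (H3 := Rmult_le_compat_r (K * q ^ N) _ _ (Rmult_le_pos _ _ HK H1) H2). lra.
Qed.

Lemma pow_INR_small (r : R) : (0 <= r < 1 / 2)%R -> forall eps, (0 < eps)%R ->
  exists N, forall n, (N <= n)%nat -> (INR (S n) * r ^ n < eps)%R.
Proof.
  intros Hr eps Heps.
  destruct (pow_lt_1_zero (2 * r) ltac:(rewrite Rabs_pos_eq; lra) eps Heps) as [N HN].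
  exists N. intros n Hn. specialize (HN n Hn).
  assert (H1 : (0 <= r ^ n)%R) by (apply pow_le; lra).
  assert (H2 := INR_S_le_pow_2 n).
  rewrite Rpow_mult_distr, Rabs_pos_eq in HN.
  - apply Rle_lt_trans with (2 := HN). now apply Rmult_le_compat_r.
  - apply Rmult_le_pos; [apply pow_le; lra | exact H1].
Qed.
(** Fubini's theorem for a double power series.  The partial sum over k <= N of the
    row sums and the partial sum of the first N + 1 diagonals differ by the tails of
    N + 1 rows, the k-th being at most K r^N with r = |x| q; and (N+1) r^N tends to 0
    for r < 1/2. *)
Lemma pser_rows_diagonals (K q : R) (a : nat -> nat -> C) (s : nat -> C) (x : C) :
  (0 <= K)%R -> (0 <= q)%R ->
  (forall k m, (Cmod (a k m) <= K * q ^ k * q ^ m)%R) ->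
  (Cmod x * q < 1 / 2)%R ->
  (forall k, is_pser (a k) x (s k)) ->
  exists l, is_pser s x l /\
            is_pser (fun N => sum_n (fun k => a k (N - k)%nat) N) x l.
Proof.
  intros HK Hq Ha Hx Hs.
  assert (Hr : (0 <= Cmod x * q)%R) by (apply Rmult_le_pos; [apply Cmod_ge_0 | exact Hq]).
  assert (Hrow : forall k, geom_bound (K * q ^ k) q (a k)).
  { intros k. repeat split; [|exact Hq | apply Ha].
    apply Rmult_le_pos; [exact HK | now apply pow_le]. }
  assert (Htail : forall k N, (Cmod (s k - partial_sum (a k) x N)
             <= K * q ^ k * (Cmod x * q) ^ N)%R).
  { intros k N. apply Rle_trans with (1 := pser_tail _ _ _ _ _ N (Hrow k) (Rlt_le _ _ Hx) (Hs k)).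
    simpl pow. assert (H1 : (0 <= K * q ^ k * (Cmod x * q) ^ N)%R)
      by (apply Rmult_le_pos; [apply Hrow | now apply pow_le]).
    assert (H2 := Rmult_le_compat_l _ _ _ H1 (Rlt_le _ _ Hx)).
    set (t := (K * q ^ k * (Cmod x * q) ^ N)%R) in *.
    replace (2 * (K * q ^ k) * (Cmod x * q * (Cmod x * q) ^ N))%R
      with (2 * (t * (Cmod x * q)))%R by (unfold t; ring). lra. }
  assert (Hgs : geom_bound (2 * K) q s).
  { repeat split; [lra | exact Hq|]. intros k.
    assert (H1 := Htail k 0%nat). assert (H2 := Ha k 0%nat).
    unfold partial_sum in H1. rewrite sumC_O in H1. simpl Cpow in H1. simpl pow in *.
    replace (s k) with (s k - a k 0%nat * 1 + a k 0%nat) by ring.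
    apply Rle_trans with (1 := Cmod_triangle _ _). lra. }
  eexists. split; [exact (geom_bound_cv _ _ _ _ Hgs (Rlt_le _ _ Hx))|].
  assert (Hl := geom_bound_cv _ _ _ _ Hgs (Rlt_le _ _ Hx)).
  set (l := (_, _)) in *. clearbody l.
  rewrite is_pser_eps in Hl |- *. intros eps Heps.
  destruct (Hl (eps / 2)%R ltac:(lra)) as [N1 HN1].
  destruct (pow_INR_small (Cmod x * q) ltac:(lra) (eps / 2 / (K + 1))%R) as [N2 HN2].
  { apply Rdiv_lt_0_compat; lra. }
  exists (max N1 N2). intros N HN.
  specialize (HN1 N ltac:(lia)). specialize (HN2 N ltac:(lia)).
  assert (E : partial_sum (fun N => sum_n (fun k => a k (N - k)%nat) N) x N
    = sum_n (fun k => x ^ k * partial_sum (a k) x (N - k)) N).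
  { unfold partial_sum.
    transitivity (sum_n (fun M => sum_n (fun k =>
      (fun k m => x ^ k * (a k m * x ^ m)) k (M - k)%nat) M) N).
    - apply sum_n_ext. intros M. rewrite Cmult_comm, <- sumC_mult.
      apply sum_n_ext_loc. intros k Hk. replace M with (k + (M - k))%nat at 1 by lia.
      rewrite Cpow_add_r. cring.
    - rewrite (sum_triangle (fun k m => x ^ k * (a k m * x ^ m))).
      apply sum_n_ext. intros k. apply sumC_mult. }
  set (D := partial_sum (fun N => sum_n (fun k => a k (N - k)%nat) N) x N) in *.
  assert (Hd : (Cmod (partial_sum s x N - D) <= INR (S N) * (K * (Cmod x * q) ^ N))%R).
  { rewrite E. unfold partial_sum at 1. rewrite <- sumC_minus, <- sum_n_const.
    apply Cmod_sum. intros k Hk.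
    replace (s k * x ^ k - x ^ k * partial_sum (a k) x (N - k))
      with (x ^ k * (s k - partial_sum (a k) x (N - k))) by ring.
    rewrite Cmod_mult, Cmod_pow.
    apply Rle_trans with
      (1 := Rmult_le_compat_l _ _ _ (pow_le _ k (Cmod_ge_0 x)) (Htail k (N - k)%nat)).
    right. replace N with (k + (N - k))%nat at 2 by lia.
    rewrite pow_add, (Rpow_mult_distr (Cmod x) q k). ring. }
  replace (D - l) with (partial_sum s x N - l + - (partial_sum s x N - D)) by ring.
  apply Rle_lt_trans with (1 := Cmod_triangle _ _). rewrite Cmod_opp.
  apply Rlt_div_r in HN2; [|lra].
  assert (H0 : (0 <= INR (S N) * (Cmod x * q) ^ N)%R)
    by (apply Rmult_le_pos; [apply pos_INR | now apply pow_le]).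
  lra.
Qed.

(** * Analytic germs and their expansions *)

Lemma has_expansion_disk (u : nat -> C) (f : C -> C) :
  has_expansion u f <->
  exists d, (0 < d)%R /\ forall x, (Cmod x < d)%R -> is_pser u x (f x).
Proof. apply locally_C0. Qed.

(** The terms of a convergent series are bounded, here at one point r > 0. *)
Lemma has_expansion_bound (u : nat -> C) (f : C -> C) :
  has_expansion u f -> exists K q, geom_bound K q u.
Proof.
  rewrite has_expansion_disk. intros [d [Hd H]].
  set (r := (d / 2)%R). assert (Hr : (0 < r)%R) by (unfold r; lra).
  assert (Hm : Cmod (RtoC r) = r) by (rewrite Cmod_R; apply Rabs_pos_eq; lra).
  specialize (H (RtoC r)). rewrite Hm in H. specialize (H ltac:(unfold r; lra)).
  apply is_pser_series in H.
  destruct (filterlim_bounded (K := C_AbsRing) (V := C_NormedModule) _ (ex_intro _ _ H))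
    as [M HM].
  assert (HM' : forall n, (Cmod (partial_sum u r n) <= M)%R) by exact HM. clear HM.
  assert (H0 : (0 <= M)%R) by (apply Rle_trans with (2 := HM' 0%nat); apply Cmod_ge_0).
  exists (2 * M)%R, (/ r)%R. split; [lra|]. split; [left; now apply Rinv_0_lt_compat|].
  intros n.
  assert (Hn : (Cmod (u n * r ^ n) <= 2 * M)%R).
  { destruct n as [|n].
    - specialize (HM' 0%nat). unfold partial_sum in HM'. rewrite sumC_O in HM'. lra.
    - replace (u (S n) * r ^ S n) with (partial_sum u r (S n) + - partial_sum u r n).
      + apply Rle_trans with (1 := Cmod_triangle _ _). rewrite Cmod_opp.
        assert (H1 := HM' n). assert (H2 := HM' (S n)). lra.
      + unfold partial_sum at 1. rewrite sumC_S. fold (partial_sum u r n). ring. }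
  rewrite Cmod_mult, Cmod_pow, Hm in Hn. rewrite pow_inv.
  apply Rle_div_r; [|exact Hn]. now apply pow_lt.
Qed.

Lemma geom_bound_disk (q : R) : (0 <= q)%R ->
  exists d, (0 < d)%R /\ forall x : C, (Cmod x < d)%R -> (Cmod x * q < 1 / 2)%R.
Proof.
  intros Hq. exists (/ (2 * (q + 1)))%R. split.
  - apply Rinv_0_lt_compat. lra.
  - intros x Hx.
    assert (H1 : (Cmod x * (q + 1) < 1 / 2)%R).
    { apply Rmult_lt_compat_r with (r := (q + 1)%R) in Hx; [|lra].
      replace (/ (2 * (q + 1)) * (q + 1))%R with (1 / 2)%R in Hx by (field; lra). exact Hx. }
    assert (H2 := Cmod_ge_0 x). lra.
Qed.

Lemma geom_bound_expansion (K q : R) (u : nat -> C) :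
  geom_bound K q u -> exists f, has_expansion u f.
Proof.
  intros Hu.
  exists (fun x => (Series (fun k => Re (u k * x ^ k)), Series (fun k => Im (u k * x ^ k)))).
  apply has_expansion_disk.
  destruct (geom_bound_disk q) as [d [Hd H]]; [apply Hu|].
  exists d. split; [exact Hd|]. intros x Hx.
  apply geom_bound_cv with K q; [exact Hu | left; now apply H].
Qed.

Lemma geom_bound_minus (K1 q1 K2 q2 : R) (u w : nat -> C) :
  geom_bound K1 q1 u -> geom_bound K2 q2 w ->
  geom_bound (K1 + K2) (q1 + q2) (fun n => u n - w n).
Proof.
  intros [HK1 [Hq1 Hu]] [HK2 [Hq2 Hw]]. split; [lra|]. split; [lra|]. intros n.
  apply Rle_trans with (1 := Cmod_triangle _ _). rewrite Cmod_opp.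
  assert (H1 : (q1 ^ n <= (q1 + q2) ^ n)%R) by (apply pow_incr; lra).
  assert (H2 : (q2 ^ n <= (q1 + q2) ^ n)%R) by (apply pow_incr; lra).
  assert (H3 := Rmult_le_compat_l _ _ _ HK1 H1).
  assert (H4 := Rmult_le_compat_l _ _ _ HK2 H2).
  specialize (Hu n). specialize (Hw n). lra.
Qed.

Lemma geom_bound_mult (K1 q1 K2 q2 : R) (u w : nat -> C) :
  geom_bound K1 q1 u -> geom_bound K2 q2 w ->
  geom_bound (K1 * K2) (q1 * q2) (fun n => u n * w n).
Proof.
  intros [HK1 [Hq1 Hu]] [HK2 [Hq2 Hw]].
  split; [now apply Rmult_le_pos|]. split; [now apply Rmult_le_pos|]. intros n.
  rewrite Cmod_mult, Rpow_mult_distr.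
  replace (K1 * K2 * (q1 ^ n * q2 ^ n))%R with (K1 * q1 ^ n * (K2 * q2 ^ n))%R by ring.
  apply Rmult_le_compat; auto using Cmod_ge_0.
Qed.
(** Zeros are only required on some set accumulating at 0: for power series in y the
    zeros come as values y(x). *)
Definition zeros_cluster_at_0 (u : nat -> C) : Prop :=
  forall d, (0 < d)%R -> exists z : C, z <> 0 /\ (Cmod z < d)%R /\ is_pser u z 0.

(** At a zero z of the sum, |u_0| is the modulus of the tail, at most 2 K |z| q. *)
Lemma pser_null_0 (K q : R) (u : nat -> C) : geom_bound K q u ->
  zeros_cluster_at_0 u -> u 0%nat = 0.
Proof.
  intros Hu Hz.
  apply Cmod_eq_0. apply Rle_antisym; [|apply Cmod_ge_0].
  apply le_epsilon. intros eps Heps.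
  destruct Hu as [HK [Hq Hu]].
  destruct (geom_bound_disk q Hq) as [d1 [Hd1 H1]].
  destruct (geom_bound_disk (K * q / eps)) as [d2 [Hd2 H2]].
  { apply Rmult_le_pos; [now apply Rmult_le_pos | left; now apply Rinv_0_lt_compat]. }
  destruct (Hz (Rmin d1 d2) ltac:(now apply Rmin_glb_lt)) as [z [Hz0 [Hzd Hs]]].
  specialize (H1 z (Rlt_le_trans _ _ _ Hzd (Rmin_l _ _))).
  specialize (H2 z (Rlt_le_trans _ _ _ Hzd (Rmin_r _ _))).
  assert (Ht := pser_tail K q u z 0 0 (conj HK (conj Hq Hu)) (Rlt_le _ _ H1) Hs).
  unfold partial_sum in Ht. rewrite sumC_O in Ht. simpl Cpow in Ht. simpl pow in Ht.
  replace (0 - u 0%nat * 1) with (- u 0%nat) in Ht by ring. rewrite Cmod_opp in Ht.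
  replace (Cmod z * (K * q / eps))%R with (K * (Cmod z * q) / eps)%R in H2
    by (field; lra).
  apply (Rlt_div_l (K * (Cmod z * q)) (1 / 2) eps) in H2; lra.
Qed.

(** Once u_0 = 0, the series divided by z has the same zeros. *)
Lemma pser_null (K q : R) (u : nat -> C) : geom_bound K q u ->
  zeros_cluster_at_0 u -> forall n, u n = 0.
Proof.
  intros Hu Hz n. revert K u Hu Hz.
  induction n as [|n IH]; intros K u Hu Hz; [exact (pser_null_0 K q u Hu Hz)|].
  apply (IH (K * q)%R (fun k => u (S k))).
  - destruct Hu as [HK [Hq Hu]]. split; [now apply Rmult_le_pos|]. split; [exact Hq|].
    intros k. specialize (Hu (S k)). simpl in Hu. lra.
  - assert (E0 := pser_null_0 K q u Hu Hz).
    intros d Hd. destruct (Hz d Hd) as [z [Hz0 [Hzd Hs]]].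
    exists z. split; [exact Hz0|]. split; [exact Hzd|].
    assert (H := @is_pseries_decr_1 C_AbsRing C_NormedModule u z (/ z) (RtoC 0) (Cinv_l z Hz0) Hs).
    rewrite E0 in H.
    replace (RtoC 0) with (/ z * (0 + - 0)) by ring. exact H.
Qed.

Lemma pser_coef_unique (K1 q1 K2 q2 : R) (u w : nat -> C) :
  geom_bound K1 q1 u -> geom_bound K2 q2 w ->
  (forall d, (0 < d)%R -> exists z l : C, z <> 0 /\ (Cmod z < d)%R /\
      is_pser u z l /\ is_pser w z l) ->
  forall n, u n = w n.
Proof.
  intros Hu Hw H n. apply Ceq_minus.
  apply (pser_null _ _ (fun n => u n - w n) (geom_bound_minus _ _ _ _ _ _ Hu Hw)).
  intros d Hd. destruct (H d Hd) as [z [l [Hz [Hzd [H1 H2]]]]].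
  exists z. split; [exact Hz|]. split; [exact Hzd|].
  replace (0 : C) with (l - l) at 1 by ring. now apply is_pser_minus.
Qed.

Lemma has_expansion_unique (u w : nat -> C) (f : C -> C) :
  has_expansion u f -> has_expansion w f -> forall n, u n = w n.
Proof.
  intros Hu Hw.
  destruct (has_expansion_bound u f Hu) as [K1 [q1 B1]].
  destruct (has_expansion_bound w f Hw) as [K2 [q2 B2]].
  apply (pser_coef_unique _ _ _ _ _ _ B1 B2).
  apply has_expansion_disk in Hu. apply has_expansion_disk in Hw.
  destruct Hu as [d1 [Hd1 Hu]]. destruct Hw as [d2 [Hd2 Hw]].
  intros d Hd. set (r := (Rmin d (Rmin d1 d2) / 2)%R).
  assert (Hm : (0 < Rmin d (Rmin d1 d2))%R) by (repeat apply Rmin_glb_lt; assumption).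
  assert (H1 := Rmin_l d (Rmin d1 d2)). assert (H2 := Rmin_r d (Rmin d1 d2)).
  assert (H3 := Rmin_l d1 d2). assert (H4 := Rmin_r d1 d2).
  assert (Hr : Cmod r = r) by (rewrite Cmod_R; apply Rabs_pos_eq; unfold r; lra).
  exists (RtoC r), (f r). split; [|split; [|split]].
  - intros E. apply RtoC_inj in E. unfold r in E. lra.
  - rewrite Hr. unfold r. lra.
  - apply Hu. rewrite Hr. unfold r. lra.
  - apply Hw. rewrite Hr. unfold r. lra.
Qed.

Lemma germ_eq_all (f g : C -> C) : (forall x, f x = g x) -> germ_eq f g.
Proof. intros H. unfold germ_eq. now apply filter_forall. Qed.

Lemma germ_eq_refl (f : C -> C) : germ_eq f f.
Proof. now apply germ_eq_all. Qed.

Lemma has_expansion_ext (u w : nat -> C) (f g : C -> C) :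
  (forall n, u n = w n) -> germ_eq f g -> has_expansion u f -> has_expansion w g.
Proof.
  intros Huw Hfg Hu. unfold has_expansion. generalize (filter_and _ _ Hfg Hu). apply filter_imp.
  intros x [E H]. rewrite <- E. exact (is_pser_ext u w x (f x) Huw H).
Qed.

(** The rows of the double series are u_k g(x), so [pser_rows_diagonals] applies. *)
Lemma has_expansion_mult (u w : nat -> C) (f g : C -> C) :
  has_expansion u f -> has_expansion w g ->
  has_expansion (fun n => sum_n (fun k => u k * w (n - k)%nat) n) (mul_op f g).
Proof.
  intros Hu Hw.
  destruct (has_expansion_bound u f Hu) as [K1 [q1 [HK1 [Hq1 B1]]]].
  destruct (has_expansion_bound w g Hw) as [K2 [q2 [HK2 [Hq2 B2]]]].
  destruct (geom_bound_disk (q1 + q2)) as [d [Hd Hx]]; [lra|].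
  unfold has_expansion. generalize (filter_and _ _ Hu (filter_and _ _ Hw
    (proj2 (locally_C0 _) (ex_intro _ d (conj Hd Hx))))).
  apply filter_imp. intros x [H1 [H2 H3]].
  destruct (pser_rows_diagonals (K1 * K2) (q1 + q2) (fun k m => u k * w m)
    (fun k => u k * g x) x) as [l [Hl1 Hl2]].
  - now apply Rmult_le_pos.
  - lra.
  - intros k m. rewrite Cmod_mult.
    replace (K1 * K2 * (q1 + q2) ^ k * (q1 + q2) ^ m)%R with
      (K1 * (q1 + q2) ^ k * (K2 * (q1 + q2) ^ m))%R by ring.
    apply Rmult_le_compat; auto using Cmod_ge_0.
    + apply Rle_trans with (1 := B1 k). apply Rmult_le_compat_l; [exact HK1|].
      apply pow_incr. lra.
    + apply Rle_trans with (1 := B2 m). apply Rmult_le_compat_l; [exact HK2|].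
      apply pow_incr. lra.
  - exact H3.
  - intros k. now apply is_pser_mult.
  - replace (mul_op f g x) with l; [exact Hl2|].
    apply (is_pser_unique _ _ _ _ Hl1). unfold mul_op. rewrite Cmult_comm.
    apply is_pser_ext with (fun n => g x * u n); [intros; ring|].
    now apply is_pser_mult.
Qed.

(** Each factor (a+n)/(c+n) = 1 + (a-c)/(c+n) is bounded, since c + n stays away
    from 0. *)
Lemma pochhammer_ratio_bound (a c : C) : ~ nonpos_integer c ->
  exists K q, geom_bound K q (fun n => pochhammer a n / pochhammer c n).
Proof.
  intros Hc.
  assert (Hd : exists d, (0 < d)%R /\ forall n, (d <= Cmod (c + INR n))%R).
  { assert (Hfin : forall N, exists d, (0 < d)%R /\ forall n, (n < N)%nat ->
        (d <= Cmod (c + INR n))%R).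
    { induction N as [|N [d [Hd H]]].
      - exists 1%R. split; [lra | intros n Hn; lia].
      - exists (Rmin d (Cmod (c + INR N))). split.
        + apply Rmin_glb_lt; [exact Hd|]. apply Cmod_gt_0. intros E. apply Hc.
          exists N. rewrite RtoC_opp. replace c with (c + INR N - INR N) by ring.
          rewrite E. ring.
        + intros n Hn. destruct (Nat.eq_dec n N) as [->|Hne]; [apply Rmin_r|].
          apply Rle_trans with (1 := Rmin_l _ _). apply H. lia. }
    destruct (INR_unbounded (Cmod c + 1)) as [N HN].
    destruct (Hfin N) as [d [Hd H]].
    exists (Rmin d 1). split; [apply Rmin_glb_lt; lra|]. intros n.
    destruct (le_lt_dec N n) as [Hn|Hn].
    - apply Rle_trans with (1 := Rmin_r _ _).
      assert (H1 := Cmod_triangle (c + INR n) (- c)).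
      replace (c + INR n + - c) with (RtoC (INR n)) in H1 by ring.
      rewrite Cmod_opp, Cmod_R, Rabs_pos_eq in H1 by apply pos_INR.
      apply le_INR in Hn. lra.
    - apply Rle_trans with (1 := Rmin_l _ _). now apply H. }
  destruct Hd as [d [Hd H]].
  assert (Hq : (0 <= Cmod (a - c) / d)%R).
  { apply Rmult_le_pos; [apply Cmod_ge_0 | left; now apply Rinv_0_lt_compat]. }
  exists 1%R, (1 + Cmod (a - c) / d)%R. split; [lra|]. split; [lra|].
  induction n as [|n IH].
  - simpl. rewrite Rmult_1_l. replace (1 / 1) with (1 : C) by field. rewrite Cmod_1. lra.
  - assert (Hn : c + INR n <> 0).
    { apply Cmod_gt_0. specialize (H n). lra. }
    replace (pochhammer a (S n) / pochhammer c (S n)) with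
      (pochhammer a n / pochhammer c n * (1 + (a - c) / (c + INR n))).
    2:{ simpl. field. split; [exact Hn | now apply pochhammer_neq_0]. }
    rewrite Cmod_mult. simpl pow. rewrite Rmult_1_l in IH |- *. rewrite Rmult_comm.
    apply Rmult_le_compat; auto using Cmod_ge_0.
    apply Rle_trans with (1 := Cmod_triangle _ _). rewrite Cmod_1, Cmod_div by exact Hn.
    apply Rplus_le_compat_l. apply Rmult_le_compat_l; [apply Cmod_ge_0|].
    now apply Rinv_le_contravar.
Qed.

(** The chosen germ comes with some expansion of [f], which must be the given one. *)
Lemma hypergeometrization_spec (a c : C) (u : nat -> C) (f : C -> C) :
  ~ nonpos_integer c -> has_expansion u f ->
  has_expansion (fun n => u n * (pochhammer a n / pochhammer c n))
    (hypergeometrization a c f).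
Proof.
  intros Hc Hu.
  assert (H : is_hypergeometrization a c f (hypergeometrization a c f)).
  { apply (epsilon_spec (inhabits f) (is_hypergeometrization a c f)).
    destruct (has_expansion_bound u f Hu) as [K1 [q1 B1]].
    destruct (pochhammer_ratio_bound a c Hc) as [K2 [q2 B2]].
    destruct (geom_bound_expansion _ _ _ (geom_bound_mult _ _ _ _ _ _ B1 B2)) as [g Hg].
    exists g, u. now split. }
  destruct H as [w [Hw H]]. revert H. apply has_expansion_ext.
  - intros n. now rewrite (has_expansion_unique w u f Hw Hu n).
  - apply germ_eq_refl.
Qed.
(** * The binomial series *)

(** For Q a natural number, (Q)_m / m! is a binomial coefficient; the induction is Pascal's
    rule.  The base 2 does not depend on Q, so the bound stays geometric when Q grows
    linearly with another index. *)
Lemma pochhammer_INR_bound (Q m : nat) :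
  (Cmod (pochhammer (INR Q) m) <= 2 ^ (Q + m) * INR (fact m))%R.
Proof.
  revert m. induction Q as [|Q IHQ].
  - intros [|m].
    + simpl. rewrite Cmod_1. lra.
    + rewrite pochhammer_head. simpl INR at 1. rewrite Cmult_0_l, Cmod_0.
      apply Rmult_le_pos; [apply pow_le; lra | apply pos_INR].
  - induction m as [|m IHm].
    + simpl pochhammer. rewrite Cmod_1. simpl fact. simpl INR. rewrite Rmult_1_r.
      apply pow_R1_Rle. lra.
    + assert (E : pochhammer (INR (S Q)) (S m) = pochhammer (INR Q) (S m)
                  + (INR m + 1) * pochhammer (INR (S Q)) m).
      { rewrite (pochhammer_head (INR Q)). rewrite S_INR, RtoC_plus. simpl. ring. }
      rewrite E. apply Rle_trans with (1 := Cmod_triangle _ _).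
      specialize (IHQ (S m)).
      rewrite Cmod_mult, <- RtoC_plus, Cmod_R, Rabs_pos_eq
        by (assert (H := pos_INR m); lra).
      assert (H1 := Rmult_le_compat_l (INR m + 1) _ _ ltac:(assert (H := pos_INR m); lra) IHm).
      rewrite fact_simpl, mult_INR, S_INR in IHQ |- *.
      replace (Q + S m)%nat with (S Q + m)%nat in IHQ by lia.
      replace (S Q + S m)%nat with (S (S Q + m)) by lia.
      change (2 ^ S (S Q + m))%R with (2 * 2 ^ (S Q + m))%R.
      set (t := (2 ^ (S Q + m))%R) in *. rewrite !S_INR in *. lra.
Qed.

Lemma pochhammer_bound (q : C) (Q m : nat) : (Cmod q <= INR Q)%R ->
  (Cmod (pochhammer q m) <= 2 ^ (Q + m) * INR (fact m))%R.
Proof.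
  intros Hq. apply Rle_trans with (2 := pochhammer_INR_bound Q m).
  induction m as [|m IH].
  - simpl. lra.
  - simpl. rewrite !Cmod_mult. apply Rmult_le_compat; auto using Cmod_ge_0.
    rewrite <- RtoC_plus, Cmod_R, Rabs_pos_eq
      by (assert (H1 := pos_INR Q); assert (H2 := pos_INR m); lra).
    apply Rle_trans with (1 := Cmod_triangle _ _).
    rewrite Cmod_R, (Rabs_pos_eq (INR m)) by apply pos_INR. lra.
Qed.

Lemma Cmod_fact (n : nat) : Cmod (INR (fact n)) = INR (fact n).
Proof. rewrite Cmod_R. apply Rabs_pos_eq, pos_INR. Qed.

Lemma binom_coef_bound (q : C) (Q m : nat) : (Cmod q <= INR Q)%R ->
  (Cmod (binom_coef q m) <= 2 ^ Q * 2 ^ m)%R.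
Proof.
  intros Hq. unfold binom_coef. rewrite Cmod_div, Cmod_fact by apply fact_C_neq_0.
  apply Rle_div_l; [apply lt_0_INR, lt_O_fact|].
  rewrite <- pow_add. now apply pochhammer_bound.
Qed.

Lemma catalan_coef_bound (s : C) (B k : nat) : (Cmod s <= INR B)%R ->
  (Cmod (catalan_coef s k) <= 4 ^ B * 4 ^ k)%R.
Proof.
  intros Hs. assert (H4 : forall n, (4 ^ n = 2 ^ n * 2 ^ n)%R).
  { intros n. rewrite <- Rpow_mult_distr. f_equal; ring. }
  destruct k as [|m].
  - simpl. rewrite Cmod_1, Rmult_1_r. apply pow_R1_Rle. lra.
  - unfold catalan_coef. rewrite Cmod_div, Cmod_fact, Cmod_mult by apply fact_C_neq_0.
    assert (Hf := lt_0_INR _ (lt_O_fact m)). assert (Hf' := lt_0_INR _ (lt_O_fact (S m))).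
    apply Rle_div_l; [exact Hf'|].
    assert (H1 : (Cmod (pochhammer (s + INR (S m) + 1) m)
                  <= 2 ^ (B + S (S m) + m) * INR (fact m))%R).
    { apply pochhammer_bound.
      replace (s + INR (S m) + 1) with (s + INR (S (S m)))
        by (rewrite (S_INR (S m)), RtoC_plus; ring).
      apply Rle_trans with (1 := Cmod_triangle _ _).
      rewrite plus_INR, Cmod_R, Rabs_pos_eq by apply pos_INR. lra. }
    assert (H2 := INR_S_le_pow_2 B). rewrite S_INR in H2.
    assert (H3 : (INR (fact m) <= INR (fact (S m)))%R) by (apply le_INR, fact_le; lia).
    replace (B + S (S m) + m)%nat with (B + (S m + S m))%nat in H1 by lia.
    apply Rle_trans with (2 ^ B * (2 ^ (B + (S m + S m)) * INR (fact m)))%R.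
    + apply Rmult_le_compat; auto using Cmod_ge_0. lra.
    + rewrite !pow_add, !H4.
      replace (2 ^ B * (2 ^ B * (2 ^ S m * 2 ^ S m) * INR (fact m)))%R
        with (2 ^ B * 2 ^ B * (2 ^ S m * 2 ^ S m) * INR (fact m))%R by ring.
      apply Rmult_le_compat_l; [|exact H3].
      repeat apply Rmult_le_pos; try apply pow_le; lra.
Qed.

Definition is_derive_C (f : R -> C) (t : R) (d : C) : Prop :=
  is_derive (fun t => Re (f t)) t (Re d) /\ is_derive (fun t => Im (f t)) t (Im d).

Ltac solve_derive :=
  auto_derive;
  [ repeat split; eexists; eassumption
  | repeat match goal with H : is_derive ?f ?t ?d |- context [Derive (fun x => ?f x) ?t] =>
      replace (Derive (fun x => f x) t) with d
        by (symmetry; exact (is_derive_unique _ _ _ H)); clear H end ].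

Lemma is_derive_C_mult (f g : R -> C) (t : R) (df dg : C) :
  is_derive_C f t df -> is_derive_C g t dg ->
  is_derive_C (fun t => f t * g t) t (df * g t + f t * dg).
Proof.
  intros [F1 F2] [G1 G2].
  assert (H : forall p q r s : R -> R, forall p' q' r' s' t e : R,
    is_derive p t p' -> is_derive q t q' -> is_derive r t r' -> is_derive s t s' ->
    is_derive (fun t => p t * q t + e * (r t * s t))%R t
      (p' * q t + p t * q' + e * (r' * s t + r t * s'))%R).
  { clear. intros p q r s p' q' r' s' t e Hp Hq Hr Hs. solve_derive. ring. }
  split.
  - assert (E := H _ _ _ _ _ _ _ _ _ (-1)%R F1 G1 F2 G2).
    refine (is_derive_ext _ _ _ _ _ (eq_rect _ _ E _ _)).
    + intros x. cbv beta. unfold Cmult, Re, Im. simpl. ring.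
    + unfold Cmult, Cplus, Re, Im. simpl. ring.
  - assert (E := H _ _ _ _ _ _ _ _ _ 1%R F1 G2 F2 G1).
    refine (is_derive_ext _ _ _ _ _ (eq_rect _ _ E _ _)).
    + intros x. cbv beta. unfold Cmult, Re, Im. simpl. ring.
    + unfold Cmult, Cplus, Re, Im. simpl. ring.
Qed.

Lemma is_derive_C_const (z : C) (t : R) : is_derive_C (fun _ => z) t 0.
Proof. split; apply @is_derive_const. Qed.

Lemma is_derive_C_exp (f : R -> C) (t : R) (d : C) :
  is_derive_C f t d -> is_derive_C (fun t => Cexp (f t)) t (d * Cexp (f t)).
Proof.
  intros [F1 F2].
  assert (H : forall p q : R -> R, forall p' q' t : R, is_derive p t p' -> is_derive q t q' ->
    is_derive (fun t => exp (p t) * cos (q t))%R t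
      (p' * (exp (p t) * cos (q t)) - q' * (exp (p t) * sin (q t)))%R /\
    is_derive (fun t => exp (p t) * sin (q t))%R t
      (p' * (exp (p t) * sin (q t)) + q' * (exp (p t) * cos (q t)))%R).
  { clear. intros p q p' q' t Hp Hq. split; solve_derive; ring. }
  exact (H _ _ _ _ _ F1 F2).
Qed.

(** The logarithm is given by real formulas, so it is differentiated along the ray
    from 1 to 1 - z, coordinate by coordinate. *)
Lemma is_derive_C_log_ray (z : C) (t : R) : (0 < 1 - t * Re z)%R ->
  is_derive_C (fun t => Clog (1 - t * z)) t (- z / (1 - t * z)).
Proof.
  destruct z as [p q]. simpl Re. intros Hm.
  assert (HD : (0 < (1 - t * p) * (1 - t * p) + t * q * (t * q))%R).
  { assert (H1 := Rmult_lt_0_compat _ _ Hm Hm). assert (H2 := Rle_0_sqr (t * q)).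
    unfold Rsqr in H2. lra. }
  assert (HS := sqrt_lt_R0 _ HD).
  assert (HSS := sqrt_sqrt _ (Rlt_le _ _ HD)).
  assert (Hz : - (p, q) / (1 - t * (p, q)) =
    ((- p * (1 - t * p) + t * q * q) / ((1 - t * p) * (1 - t * p) + t * q * (t * q)),
     (- q) / ((1 - t * p) * (1 - t * p) + t * q * (t * q)))%R).
  { unfold Cdiv, Cinv, Cmult, Cminus, Cplus, Copp, RtoC. simpl.
    f_equal; field; lra. }
  rewrite Hz. clear Hz. split.
  - apply is_derive_ext with
      (fun t => ln (sqrt ((1 - t * p) * (1 - t * p) + t * q * (t * q))))%R.
    + intros x. unfold Clog. simpl. unfold Cmod. simpl. do 2 f_equal. ring.
    + simpl Re. auto_derive.
      * split; [exact HD | split; [exact HS | exact I]].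
      * set (S := sqrt _) in *.
        replace ((1 - t * p) * (1 - t * p) + t * q * (t * q))%R with (S * S)%R.
        field. lra.
  - apply is_derive_ext with
      (fun t => 2 * atan (- (t * q)
         / (sqrt ((1 - t * p) * (1 - t * p) + t * q * (t * q)) + (1 - t * p))))%R.
    + intros x. unfold Clog. simpl. unfold Cmod. simpl. do 2 f_equal.
      f_equal; [ring|]. f_equal; [f_equal; ring|ring].
    + simpl Im. auto_derive;
        change (1 + - (t * p))%R with (1 - t * p)%R.
      * split; [exact HD | split; [lra | exact I]].
      * set (S := sqrt _) in *. rewrite <- HSS.
        set (X := (- (1 * p) * (1 - t * p) + (1 - t * p) * - (1 * p)
                   + (1 * q * (t * q) + t * q * (1 * q)))%R).
        (* Everything is expressed through S and W: tp = 1 - W + S, and the derivative X of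
           S^2 enters only as tX. *)
        assert (HX : (t * X = 2 * (S * S - (1 - t * p)))%R)
          by (rewrite HSS; unfold X; ring).
        set (W := (S + (1 - t * p))%R).
        assert (HW : (0 < W)%R) by (unfold W; lra).
        assert (E : (1 + - (t * q) * / W * (- (t * q) * / W * 1) = 2 * S / W)%R).
        { transitivity ((W * W + t * q * (t * q)) / (W * W))%R; [field; lra|].
          replace (t * q * (t * q))%R with (S * S - (1 - t * p) * (1 - t * p))%R
            by (rewrite HSS; ring).
          replace (1 - t * p)%R with (W - S)%R by (unfold W; ring). field. lra. }
        rewrite E.
        transitivity (2 * (- q / W + q * (t * X / (2 * S) - t * p) / (W * W)) / (2 * S / W))%R.
        { field. lra. }
        rewrite HX.
        replace (1 - t * p)%R with (W - S)%R by (unfold W; ring).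
        replace (t * p)%R with (1 - W + S)%R by (unfold W; ring).
        field. lra.
Qed.

Lemma Cexp_plus (u v : C) : Cexp (u + v) = Cexp u * Cexp v.
Proof.
  destruct u as [a b], v as [c d]. unfold Cexp, Cmult, Cplus. simpl.
  rewrite exp_plus, cos_plus, sin_plus. f_equal; ring.
Qed.

Lemma Cexp_0 : Cexp 0 = 1.
Proof.
  unfold Cexp. simpl. rewrite exp_0, cos_0, sin_0. unfold RtoC. f_equal; ring.
Qed.

Lemma Clog_1 : Clog 1 = 0.
Proof.
  unfold Clog. rewrite Cmod_1, ln_1. simpl.
  replace (0 / (1 + 1))%R with 0%R by field. rewrite atan_0. unfold RtoC. f_equal; ring.
Qed.

(** The radius is at least 2/(1+q), which exceeds 1 and still satisfies
    q * 2/(1+q) <= 1. *)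
Lemma CV_radius_geom (K q : R) (a : nat -> R) : (0 <= q < 1)%R ->
  (forall n, (Rabs (a n) <= K * q ^ n)%R) ->
  forall t, (0 <= t <= 1)%R -> Rbar_lt (Rabs t) (CV_radius a).
Proof.
  intros Hq Ha t Ht.
  apply Rbar_lt_le_trans with (Finite (2 / (1 + q))).
  - simpl. rewrite Rabs_pos_eq by lra. apply Rle_lt_trans with 1%R; [lra|].
    apply (Rlt_div_r 1 2 (1 + q)); lra.
  - apply CV_radius_bounded. exists K. intros n.
    rewrite Rabs_mult, (Rabs_pos_eq (_ ^ n)).
    2:{ apply pow_le, Rlt_le, Rdiv_lt_0_compat; lra. }
    assert (H1 : (0 <= (2 / (1 + q)) ^ n)%R) by (apply pow_le, Rlt_le, Rdiv_lt_0_compat; lra).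
    apply Rle_trans with (1 := Rmult_le_compat_r _ _ _ H1 (Ha n)).
    rewrite Rmult_assoc, <- Rpow_mult_distr.
    assert (HK : (0 <= K)%R).
    { specialize (Ha 0%nat). simpl in Ha. assert (H2 := Rabs_pos (a 0%nat)). lra. }
    rewrite <- (Rmult_1_r K) at 2. apply Rmult_le_compat_l; [exact HK|].
    apply Rle_trans with (1 ^ n)%R; [|rewrite pow1; lra]. apply pow_incr. split.
    + apply Rmult_le_pos; [lra|]. apply Rlt_le, Rdiv_lt_0_compat; lra.
    + replace (q * (2 / (1 + q)))%R with (2 * q / (1 + q))%R by (field; lra).
      apply (Rle_div_l (2 * q) 1 (1 + q)); lra.
Qed.

(** The binomial series at t z, as a function of the real variable [t]. *)
Definition binom_ray (s z : C) (t : R) : C :=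
  (PSeries (fun n => Re (binom_coef s n * z ^ n)) t,
   PSeries (fun n => Im (binom_coef s n * z ^ n)) t).

Lemma Re_Im_real_mult (r : R) (w : C) :
  Re (RtoC r * w) = (r * Re w)%R /\ Im (RtoC r * w) = (r * Im w)%R.
Proof. destruct w as [a b]. simpl. split; ring. Qed.

(** With P = binom_ray s z, the recurrence of the coefficients gives
    P' = z (s P + t P'), which is solved for P'. *)
Lemma binom_ray_derive (s z : C) (t : R) : (Cmod z < 1 / 2)%R -> (0 <= t <= 1)%R ->
  is_derive_C (binom_ray s z) t (s * z / (1 - t * z) * binom_ray s z t).
Proof.
  intros Hz Ht.
  destruct (INR_unbounded (Cmod s)) as [Q HQ].
  set (P := fun n => binom_coef s n * z ^ n).
  assert (HP : forall n, (Cmod (P n) <= 2 ^ Q * (2 * Cmod z) ^ n)%R).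
  { intros n. unfold P. rewrite Cmod_mult, Cmod_pow, Rpow_mult_distr, <- Rmult_assoc.
    apply Rmult_le_compat_r; [apply pow_le, Cmod_ge_0|].
    apply binom_coef_bound. lra. }
  assert (H2z : (0 <= 2 * Cmod z < 1)%R) by (assert (H := Cmod_ge_0 z); lra).
  set (A := fun n => Re (P n)). set (B := fun n => Im (P n)).
  assert (RA : Rbar_lt (Rabs t) (CV_radius A)).
  { apply CV_radius_geom with (2 ^ Q)%R (2 * Cmod z)%R; [exact H2z | | exact Ht].
    intros n. apply Rle_trans with (2 := HP n). apply re_le_Cmod. }
  assert (RB : Rbar_lt (Rabs t) (CV_radius B)).
  { apply CV_radius_geom with (2 ^ Q)%R (2 * Cmod z)%R; [exact H2z | | exact Ht].
    intros n. apply Rle_trans with (2 := HP n). apply im_le_Cmod. }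
  assert (SA := PSeries_correct _ _ (CV_radius_inside _ _ RA)).
  assert (SB := PSeries_correct _ _ (CV_radius_inside _ _ RB)).
  assert (SA' := is_pseries_derive _ _ RA).
  assert (SB' := is_pseries_derive _ _ RB).
  assert (DA := is_derive_PSeries _ _ RA).
  assert (DB := is_derive_PSeries _ _ RB).
  rewrite <- (Derive_PSeries _ _ RA) in DA. rewrite <- (Derive_PSeries _ _ RB) in DB.
  set (a := PSeries A t) in *. set (b := PSeries B t) in *.
  set (a' := Derive (PSeries A) t) in *. set (b' := Derive (PSeries B) t) in *.
  assert (HS : forall n, (RtoC (INR (S n))) * P (S n) = z * (s * P n + INR n * P n)).
  { intros n. unfold P. simpl Cpow.
    transitivity ((INR n + 1) * binom_coef s (S n) * (z * z ^ n)).
    - rewrite S_INR, RtoC_plus. ring.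
    - rewrite binom_coef_S. ring. }
  assert (Hcomb : forall a1 a2 p q : R,
    is_pseries (fun n => a1 * A n + a2 * B n + p * (INR n * A n) + q * (INR n * B n))%R t
      (a1 * a + a2 * b + p * (t * a') + q * (t * b'))%R).
  { intros a1 a2 p q.
    assert (Hmc : forall c : R, mult t c = mult c t) by (intros c; apply Rmult_comm).
    assert (E1 := is_pseries_scal a1 A t a (Hmc a1) SA).
    assert (E2 := is_pseries_scal a2 B t b (Hmc a2) SB).
    assert (E3 := is_pseries_scal p _ t _ (Hmc p) (is_pseries_incr_1 _ _ _ SA')).
    assert (E4 := is_pseries_scal q _ t _ (Hmc q) (is_pseries_incr_1 _ _ _ SB')).
    refine (is_pseries_ext _ _ _ _ _ (is_pseries_plus _ _ _ _ _
      (is_pseries_plus _ _ _ _ _ (is_pseries_plus _ _ _ _ _ E1 E2) E3) E4)).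
    intros n. unfold PS_plus, PS_scal, PS_incr_1, PS_derive. destruct n as [|n].
    - change (a1 * A 0%nat + a2 * B 0%nat + p * 0 + q * 0
        = a1 * A 0%nat + a2 * B 0%nat + p * (0 * A 0%nat) + q * (0 * B 0%nat))%R. ring.
    - reflexivity. }
  assert (Ea : a' = Re (z * (s * (a, b) + t * (a', b')))).
  { transitivity (PSeries (PS_derive A) t); [symmetry; now apply is_pseries_unique|].
    apply is_pseries_unique.
    assert (E := Hcomb (Re (z * s)) (- Im (z * s))%R (Re z) (- Im z)%R).
    replace (Re (z * (s * (a, b) + t * (a', b')))) with
      (Re (z * s) * a + - Im (z * s) * b + Re z * (t * a') + - Im z * (t * b'))%R
      by (destruct z, s; simpl; ring).
    refine (is_pseries_ext _ _ _ _ _ E). intros n. unfold PS_derive.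
    transitivity (Re (RtoC (INR (S n)) * P (S n))).
    - rewrite HS. unfold A, B. destruct z, s, (P n). simpl. ring.
    - apply Re_Im_real_mult. }
  assert (Eb : b' = Im (z * (s * (a, b) + t * (a', b')))).
  { transitivity (PSeries (PS_derive B) t); [symmetry; now apply is_pseries_unique|].
    apply is_pseries_unique.
    assert (E := Hcomb (Im (z * s)) (Re (z * s))%R (Im z) (Re z)%R).
    replace (Im (z * (s * (a, b) + t * (a', b')))) with
      (Im (z * s) * a + Re (z * s) * b + Im z * (t * a') + Re z * (t * b'))%R
      by (destruct z, s; simpl; ring).
    refine (is_pseries_ext _ _ _ _ _ E). intros n. unfold PS_derive.
    transitivity (Im (RtoC (INR (S n)) * P (S n))).
    - rewrite HS. unfold A, B. destruct z, s, (P n). simpl. ring.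
    - apply Re_Im_real_mult. }
  assert (Hab : (a', b') = z * (s * (a, b) + t * (a', b'))).
  { set (w := z * _) in *. transitivity (Re w, Im w).
    - now rewrite <- Ea, <- Eb.
    - symmetry. apply surjective_pairing. }
  assert (Hn : 1 - t * z <> 0).
  { intros E. apply Ceq_minus in E. assert (H : Cmod (t * z) = 1%R) by now rewrite <- E, Cmod_1.
    rewrite Cmod_mult, Cmod_R, Rabs_pos_eq in H by lra.
    assert (H1 := Rmult_le_compat_r (Cmod z) t 1 (Cmod_ge_0 z) (proj2 Ht)). lra. }
  assert (Hd : s * z / (1 - t * z) * binom_ray s z t = (a', b')).
  { change (binom_ray s z t) with ((a, b) : C).
    transitivity ((z * (s * (a, b) + t * (a', b')) - t * z * (a', b')) / (1 - t * z)).
    - field. exact Hn.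
    - rewrite <- Hab. field. exact Hn. }
  rewrite Hd. split; [exact DA | exact DB].
Qed.

(** The product of the series for (1-tz)^(-s) with (1-tz)^s has derivative 0 in
    t, and equals 1 at t = 0. *)
Lemma binomial_series (s z : C) : (Cmod z < 1 / 4)%R ->
  is_pser (binom_coef s) z (Cpower (1 - z) (- s)).
Proof.
  intros Hz.
  (* By definition [Cexp (s * Clog (1 - t * z))] is (1 - tz)^s. *)
  set (M := fun t : R => Cexp (s * Clog (1 - t * z)) * binom_ray s z t).
  assert (HM : forall t, (0 <= t <= 1)%R -> is_derive_C M t 0).
  { intros t Ht.
    assert (Hr : (0 < 1 - t * Re z)%R).
    { assert (H1 := re_le_Cmod z). assert (H2 := Rle_abs (Re z)).
      assert (H3 : (t * Re z <= t * (1 / 2))%R) by (apply Rmult_le_compat_l; lra). lra. }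
    assert (E := is_derive_C_mult _ _ _ _ _
      (is_derive_C_exp _ _ _
         (is_derive_C_mult _ _ _ _ _ (is_derive_C_const s t) (is_derive_C_log_ray z t Hr)))
      (binom_ray_derive s z t ltac:(lra) Ht)).
    refine (eq_rect _ (is_derive_C M t) E _ _). cbv beta. field.
    intros H. apply (f_equal Re) in H. destruct z as [p q]. simpl in *. lra. }
  assert (E : M 0%R = M 1%R).
  { rewrite (surjective_pairing (M 0%R)), (surjective_pairing (M 1%R)). f_equal.
    - apply (eq_is_derive (fun t => Re (M t)) 0 1); [|lra]. intros t Ht. now apply HM.
    - apply (eq_is_derive (fun t => Im (M t)) 0 1); [|lra]. intros t Ht. now apply HM. }
  unfold M in E.
  replace (1 - RtoC 0 * z) with (RtoC 1) in E by ring.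
  replace (1 - RtoC 1 * z) with (1 - z) in E by ring.
  rewrite Clog_1, Cmult_0_r, Cexp_0 in E.
  assert (E0 : binom_ray s z 0 = 1).
  { unfold binom_ray. rewrite !PSeries_0. simpl Cpow.
    replace (binom_coef s 0 * 1) with (RtoC 1) by (unfold binom_coef; simpl; field).
    reflexivity. }
  rewrite E0 in E.
  assert (E1 : Cpower (1 - z) (- s) = binom_ray s z 1).
  { unfold Cpower.
    transitivity (Cexp (- s * Clog (1 - z)) * (1 * 1)); [ring|]. rewrite E.
    rewrite Cmult_assoc, <- Cexp_plus.
    replace (- s * Clog (1 - z) + s * Clog (1 - z)) with (RtoC 0) by ring.
    rewrite Cexp_0. ring. }
  rewrite E1.
  destruct (INR_unbounded (Cmod s)) as [Q HQ].
  replace (binom_ray s z 1) with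
    ((Series (fun k => Re (binom_coef s k * z ^ k)),
      Series (fun k => Im (binom_coef s k * z ^ k))) : C).
  - apply geom_bound_cv with (2 ^ Q)%R 2%R; [|lra].
    split; [apply pow_le; lra|]. split; [lra|]. intros n. apply binom_coef_bound. lra.
  - unfold binom_ray, PSeries. f_equal; apply Series_ext; intros n; rewrite pow1; ring.
Qed.

Lemma Cpower_expansion (s : C) :
  has_expansion (binom_coef s) (fun x => Cpower (1 - x) (- s)).
Proof.
  apply has_expansion_disk. exists (1 / 4)%R. split; [lra|].
  intros x Hx. now apply binomial_series.
Qed.

Lemma Cpower_plus (z s t : C) : Cpower z (s + t) = Cpower z s * Cpower z t.
Proof. unfold Cpower. rewrite <- Cexp_plus. f_equal. ring. Qed.

Lemma Cpower_0 (z : C) : Cpower z 0 = 1.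
Proof. unfold Cpower. rewrite Cmult_0_l. apply Cexp_0. Qed.

Lemma is_pser_finite (u : nat -> C) (z : C) (N : nat) :
  (forall n, (N < n)%nat -> u n = 0) -> is_pser u z (partial_sum u z N).
Proof.
  intros H. apply is_pser_eps. intros eps Heps. exists N. intros n Hn.
  assert (E : partial_sum u z n = partial_sum u z N).
  { induction Hn as [|n Hn IH]; [reflexivity|]. unfold partial_sum at 1.
    rewrite sumC_S, H by lia. fold (partial_sum u z n). rewrite IH. ring. }
  rewrite E. replace (partial_sum u z N - partial_sum u z N) with (RtoC 0) by ring. now rewrite Cmod_0.
Qed.

(** Read off the binomial series for the exponent 1, which is finite; this avoids
    proving that [Cexp] inverts [Clog]. *)
Lemma Cpower_1 (z : C) : (Cmod z < 1 / 4)%R -> Cpower (1 - z) 1 = 1 - z.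
Proof.
  intros Hz.
  assert (E := binomial_series (- (1)) z Hz).
  replace (- - (1)) with (RtoC 1) in E by ring.
  assert (Hfin : forall n, (1 < n)%nat -> binom_coef (- (1)) n = 0).
  { intros [|[|n]] Hn; [lia | lia |]. unfold binom_coef.
    rewrite !pochhammer_head.
    replace (- (1) + 1) with (RtoC 0) by ring. field. apply fact_C_neq_0. }
  rewrite (is_pser_unique _ _ _ _ E (is_pser_finite _ z 1 Hfin)).
  unfold partial_sum. rewrite sumC_S, sumC_O. unfold binom_coef. simpl. field.
Qed.

Lemma Cpower_INR (z : C) (n : nat) : (Cmod z < 1 / 4)%R ->
  Cpower (1 - z) (INR n) = (1 - z) ^ n.
Proof.
  intros Hz. induction n as [|n IH].
  - apply Cpower_0.
  - rewrite S_INR, RtoC_plus, Cpower_plus, IH, Cpower_1 by exact Hz. simpl. ring.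
Qed.

(** * The change of variable y = -4x / (1-x)^2 *)

(** Equivalently, -y/4 is the Koebe function x/(1-x)^2. *)
Definition ymap (x : C) : C := - (4) * x / (1 - x) ^ 2.

Lemma one_minus_neq_0 (x : C) : (Cmod x < 1)%R -> 1 - x <> 0.
Proof.
  intros Hx E. apply Ceq_minus in E. rewrite <- E, Cmod_1 in Hx. lra.
Qed.

Lemma ymap_pow (x : C) (n : nat) : (Cmod x < 1 / 4)%R ->
  (- 1 / 4) ^ n * ymap x ^ n * Cpower (1 - x) (2 * INR n) = x ^ n.
Proof.
  intros Hx.
  replace (2 * INR n) with (RtoC (INR (2 * n)))
    by (rewrite mult_INR, RtoC_mult; reflexivity).
  rewrite Cpower_INR, Cpow_mult_r, <- !Cpow_mult_l by exact Hx. f_equal.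
  unfold ymap. field. apply one_minus_neq_0. lra.
Qed.

Lemma ymap_bound (x : C) : (Cmod x <= 1 / 2)%R -> (Cmod (ymap x) <= 16 * Cmod x)%R.
Proof.
  intros Hx. unfold ymap.
  assert (H1 : (1 / 2 <= Cmod (1 - x))%R).
  { assert (H := Cmod_triangle (1 - x) x). replace (1 - x + x) with (RtoC 1) in H by ring.
    rewrite Cmod_1 in H. lra. }
  rewrite Cmod_div by (apply Cpow_nz, one_minus_neq_0; lra).
  rewrite Cmod_mult, Cmod_opp, Cmod_R, Cmod_pow, Rabs_pos_eq by lra.
  apply Rle_div_l; [apply pow_lt; lra|].
  assert (H2 : (1 / 4 <= Cmod (1 - x) ^ 2)%R).
  { replace (1 / 4)%R with ((1 / 2) ^ 2)%R by field. apply pow_incr. lra. }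
  assert (H3 := Rmult_le_compat_l (16 * Cmod x) _ _ ltac:(assert (H := Cmod_ge_0 x); lra) H2).
  lra.
Qed.

Lemma ymap_neq_0 (x : C) : x <> 0 -> (Cmod x < 1)%R -> ymap x <> 0.
Proof.
  intros Hx H1 E. apply Hx.
  assert (H := one_minus_neq_0 x H1).
  replace x with (- (1) / 4 * (1 - x) ^ 2 * ymap x) by (unfold ymap; field; exact H).
  rewrite E. ring.
Qed.

Lemma locally_ymap (P : C -> Prop) :
  locally (0 : C) P -> locally (0 : C) (fun x => P (ymap x)).
Proof.
  rewrite !locally_C0. intros [d [Hd H]].
  exists (Rmin (1 / 2) (d / 16)). split; [apply Rmin_glb_lt; lra|].
  intros x Hx. apply H.
  assert (H1 := Rmin_l (1 / 2) (d / 16)). assert (H2 := Rmin_r (1 / 2) (d / 16)).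
  assert (H3 := ymap_bound x ltac:(lra)). lra.
Qed.

(** Expanding each (y/4)^k = (-x)^k (1-x)^(-2k) in powers of x and multiplying by
    (1-x)^(-s) gives the series 1, by [catalan_coef_binom_sum].  The disk does not
    depend on [s], which is needed to use the lemma for infinitely many exponents at
    once. *)
Lemma catalan_coef_series (s x : C) : (Cmod x < 1 / 64)%R ->
  is_pser (fun k => catalan_coef s k / 4 ^ k) (ymap x) (Cpower (1 - x) s).
Proof.
  intros Hx. destruct (INR_unbounded (Cmod s)) as [B HB].
  destruct (pser_rows_diagonals (4 ^ B * 2 ^ B) 16
    (fun k m => (-1) ^ k * catalan_coef s k * binom_coef (2 * INR k + s) m)
    (fun k => (-1) ^ k * catalan_coef s k * Cpower (1 - x) (- (2 * INR k + s))) x)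
    as [l [H1 H2]].
  - apply Rmult_le_pos; apply pow_le; lra.
  - lra.
  - intros k m. rewrite !Cmod_mult, Cmod_pow.
    replace (Cmod (-1)) with 1%R by (rewrite Cmod_R, Rabs_left; lra).
    rewrite pow1, Rmult_1_l.
    assert (G := catalan_coef_bound s B k ltac:(lra)).
    assert (H : (Cmod (2 * INR k + s) <= INR (2 * k + B))%R).
    { apply Rle_trans with (1 := Cmod_triangle _ _).
      rewrite Cmod_mult, !Cmod_R, (Rabs_pos_eq 2), (Rabs_pos_eq (INR k)), plus_INR, mult_INR
        by (lra || apply pos_INR). simpl (INR 2). lra. }
    assert (G2 := binom_coef_bound _ _ m H).
    apply Rle_trans with (4 ^ B * 4 ^ k * (2 ^ (2 * k + B) * 2 ^ m))%R.
    + apply Rmult_le_compat; auto using Cmod_ge_0.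
    + rewrite pow_add, pow_mult. replace (2 ^ 2)%R with 4%R by ring.
      replace (4 ^ B * 4 ^ k * (4 ^ k * 2 ^ B * 2 ^ m))%R
        with (4 ^ B * 2 ^ B * (4 * 4) ^ k * 2 ^ m)%R by (rewrite Rpow_mult_distr; ring).
      replace (4 * 4)%R with 16%R by ring.
      apply Rmult_le_compat_l; [|apply pow_incr; lra].
      repeat apply Rmult_le_pos; apply pow_le; lra.
  - lra.
  - intros k. apply is_pser_mult, binomial_series. lra.
  - assert (El : l = 1).
    { apply (is_pser_unique _ _ _ _ H2).
      apply is_pser_ext with (fun N => match N return C with O => 1 | _ => 0 end).
      - intros N. symmetry. apply catalan_coef_binom_sum.
      - refine (eq_rect _ (is_pser _ x) (is_pser_finite _ x 0 _) _ _).
        + intros [|n] Hn; [lia | reflexivity].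
        + unfold partial_sum. rewrite sumC_O. simpl. ring. }
    rewrite El in H1. clear H2 El l.
    apply (is_pser_mult (Cpower (1 - x) s)) in H1. rewrite Cmult_1_r in H1.
    rewrite is_pser_series in H1 |- *. revert H1. apply is_series_ext. intros k.
    change (Cpower (1 - x) s
              * ((-1) ^ k * catalan_coef s k * Cpower (1 - x) (- (2 * INR k + s))) * x ^ k
            = catalan_coef s k / 4 ^ k * ymap x ^ k).
    rewrite <- (ymap_pow x k) by lra.
    assert (E : Cpower (1 - x) s * Cpower (1 - x) (- (2 * INR k + s))
                * Cpower (1 - x) (2 * INR k) = 1).
    { rewrite <- !Cpower_plus.
      replace (s + - (2 * INR k + s) + 2 * INR k) with (RtoC 0) by ring. apply Cpower_0. }
    transitivity ((-1) ^ k * (-1 / 4) ^ k * catalan_coef s k * ymap x ^ k *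
      (Cpower (1 - x) s * Cpower (1 - x) (- (2 * INR k + s)) * Cpower (1 - x) (2 * INR k)));
      [ring|].
    rewrite E, <- Cpow_mult_l. replace (-1 * (-1 / 4)) with (/ 4) by field.
    rewrite Cpow_inv; [unfold Cdiv; ring|]. intros H. apply RtoC_inj in H. lra.
Qed.

(** The factor 4^(2n) coming from the exponent 2(b+n) is absorbed in the base. *)
Lemma y_coef_rows_bound (b : C) (K q : R) (v : nat -> C) : geom_bound K q v ->
  exists K', (0 <= K')%R /\ forall n m,
   (Cmod (v n * (-1 / 4) ^ n * (catalan_coef (2 * (b + INR n)) m / 4 ^ m))
     <= K' * (4 * q + 1) ^ n * (4 * q + 1) ^ m)%R.
Proof.
  intros [HK [Hq Hv]]. destruct (INR_unbounded (Cmod (2 * b))) as [B HB].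
  exists (K * 4 ^ B)%R.
  assert (HK' : (0 <= K * 4 ^ B)%R) by (apply Rmult_le_pos; [exact HK | apply pow_le; lra]).
  split; [exact HK'|]. intros n m.
  assert (H : (Cmod (2 * (b + INR n)) <= INR (B + 2 * n))%R).
  { replace (2 * (b + INR n)) with (2 * b + RtoC (INR (2 * n)))
      by (rewrite mult_INR, RtoC_mult; change (INR 2) with 2%R; ring).
    apply Rle_trans with (1 := Cmod_triangle _ _).
    rewrite Cmod_R, (Rabs_pos_eq (INR _)), plus_INR by apply pos_INR. lra. }
  assert (G := catalan_coef_bound _ _ m H).
  assert (H4 : (4 : C) <> 0) by (intros E; apply RtoC_inj in E; lra).
  rewrite !Cmod_mult, Cmod_div, !Cmod_pow, Cmod_div by (try apply Cpow_nz; exact H4).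
  rewrite !Cmod_R. replace (Rabs (-1)) with 1%R by (rewrite Rabs_left; lra).
  rewrite (Rabs_pos_eq 4) by lra.
  assert (G' : (Cmod (catalan_coef (2 * (b + INR n)) m) / 4 ^ m <= 4 ^ (B + 2 * n))%R).
  { apply Rle_div_l; [apply pow_lt; lra | exact G]. }
  apply Rle_trans with (K * q ^ n * (1 / 4) ^ n * 4 ^ (B + 2 * n))%R.
  - apply Rmult_le_compat; [| | | exact G'].
    + apply Rmult_le_pos; [apply Cmod_ge_0 | apply pow_le; lra].
    + apply Rmult_le_pos; [apply Cmod_ge_0 | left; apply Rinv_0_lt_compat, pow_lt; lra].
    + apply Rmult_le_compat_r; [apply pow_le; lra | apply Hv].
  - rewrite pow_add, pow_mult.
    replace (K * q ^ n * (1 / 4) ^ n * (4 ^ B * (4 ^ 2) ^ n))%R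
      with (K * 4 ^ B * (q * (1 / 4) * (4 ^ 2)) ^ n)%R by (rewrite !Rpow_mult_distr; ring).
    replace (q * (1 / 4) * 4 ^ 2)%R with (4 * q)%R by field.
    assert (H1 : ((4 * q) ^ n <= (4 * q + 1) ^ n)%R) by (apply pow_incr; lra).
    assert (H2 : (1 <= (4 * q + 1) ^ m)%R) by (apply pow_R1_Rle; lra).
    assert (H3 := Rmult_le_compat_l _ _ _ HK' H1).
    assert (H5 : (0 <= K * 4 ^ B * (4 * q + 1) ^ n)%R)
      by (apply Rmult_le_pos; [exact HK' | apply pow_le; lra]).
    assert (H6 := Rmult_le_compat_l _ _ _ H5 H2). lra.
Qed.

(** The n-th row sums to v_n (-y/4)^n p^(2(b+n)) = p^(2b) v_n x^n. *)
Lemma y_coef_expansion (b : C) (v : nat -> C) (V : C -> C) (f : C -> C) :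
  has_expansion v V ->
  germ_eq f (fun x => Cpower (1 - x) (2 * b) * V x) ->
  exists G, has_expansion (y_coef b v) G /\ germ_eq f (fun x => G (ymap x)).
Proof.
  intros HV Hf.
  destruct (has_expansion_bound v V HV) as [K [q Hv]].
  destruct (y_coef_rows_bound b K q v Hv) as [K' [HK' Hrow]].
  assert (Hq : (0 <= 4 * q + 1)%R) by (destruct Hv as [_ [Hq _]]; lra).
  destruct (geom_bound_expansion _ _ _ (geom_bound_diagonals K' (4 * q + 1) _ HK' Hq Hrow))
    as [G HG].
  exists G. split; [exact HG|].
  destruct (geom_bound_disk (4 * q + 1) Hq) as [d [Hd Hdisk]].
  assert (Hsmall : locally (0 : C) (fun x => (Cmod x < 1 / 64)%R)).
  { apply locally_C0. exists (1 / 64)%R. split; [lra | tauto]. }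
  assert (Hdisk' := locally_ymap _ (proj2 (locally_C0 _) (ex_intro _ d (conj Hd Hdisk)))).
  assert (HGy := locally_ymap _ HG).
  unfold germ_eq in *. generalize (filter_and _ _ Hf (filter_and _ _ HV
    (filter_and _ _ Hsmall (filter_and _ _ Hdisk' HGy)))).
  apply filter_imp. intros x [E [HVx [Hx [Hyx HGx]]]]. rewrite E.
  destruct (pser_rows_diagonals K' (4 * q + 1)
    (fun n m => v n * (-1 / 4) ^ n * (catalan_coef (2 * (b + INR n)) m / 4 ^ m))
    (fun n => v n * (-1 / 4) ^ n * Cpower (1 - x) (2 * (b + INR n))) (ymap x)
    HK' Hq Hrow Hyx) as [l [H1 H2]].
  { intros n. apply is_pser_mult. now apply catalan_coef_series. }
  rewrite (is_pser_unique _ _ _ _ HGx H2).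
  apply (is_pser_unique _ _ _ _) with (2 := H1).
  apply (is_pser_mult (Cpower (1 - x) (2 * b))) in HVx.
  rewrite is_pser_series in HVx |- *. revert HVx. apply is_series_ext. intros n.
  change (Cpower (1 - x) (2 * b) * v n * x ^ n
    = v n * (-1 / 4) ^ n * Cpower (1 - x) (2 * (b + INR n)) * ymap x ^ n).
  rewrite <- (ymap_pow x n) by lra.
  replace (2 * (b + INR n)) with (2 * b + 2 * INR n) by ring. rewrite Cpower_plus. ring.
Qed.

(** [in_coordinate] returns some analytic g with f = g o y.  The series of [G] and g
    agree at the points y(x), which are nonzero and accumulate at 0, so they have the
    same coefficients. *)
Lemma in_coordinate_spec (f G : C -> C) (w : nat -> C) :
  has_expansion w G -> germ_eq f (fun x => G (ymap x)) ->
  has_expansion w (in_coordinate ymap f).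
Proof.
  intros HG Hf.
  assert (H : analytic0 (in_coordinate ymap f)
              /\ germ_eq f (fun x => in_coordinate ymap f (ymap x))).
  { apply (epsilon_spec (inhabits f)
      (fun g => analytic0 g /\ germ_eq f (fun x => g (ymap x)))).
    exists G. split; [now exists w | exact Hf]. }
  destruct H as [[u Hu] Hf'].
  destruct (has_expansion_bound w G HG) as [K1 [q1 B1]].
  destruct (has_expansion_bound u _ Hu) as [K2 [q2 B2]].
  refine (has_expansion_ext u w _ _ _ (germ_eq_refl _) Hu).
  apply (pser_coef_unique _ _ _ _ _ _ B2 B1). intros d Hd.
  assert (Hnear : locally (0 : C) (fun z : C => (Cmod z < d)%R)).
  { apply locally_C0. exists d. tauto. }
  unfold germ_eq in Hf, Hf'.
  assert (Hall := filter_and _ _ Hf (filter_and _ _ Hf' (filter_and _ _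
    (locally_ymap _ HG) (filter_and _ _ (locally_ymap _ Hu) (locally_ymap _ Hnear))))).
  apply locally_C0 in Hall. destruct Hall as [e [He Hall]].
  (* A real point r inside the common disk, and less than 1 so that y(r) is defined and
     nonzero. *)
  set (r := (Rmin e 1 / 2)%R).
  assert (H1 := Rmin_l e 1). assert (H2 := Rmin_r e 1).
  assert (H3 : (0 < Rmin e 1)%R) by (apply Rmin_glb_lt; lra).
  assert (Hr : Cmod r = r) by (rewrite Cmod_R; apply Rabs_pos_eq; unfold r; lra).
  destruct (Hall (RtoC r)) as [E1 [E2 [S1 [S2 Hlt]]]].
  { rewrite Hr. unfold r. lra. }
  exists (ymap r), (f r). split; [|split; [exact Hlt|split]].
  - apply ymap_neq_0.
    + intros E. apply RtoC_inj in E. unfold r in E. lra.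
    + rewrite Hr. unfold r. lra.
  - rewrite E2. exact S2.
  - rewrite E1. exact S1.
Qed.

(** * The operator identity *)

Theorem proposition9 (a c : C)
  (hc : ~ nonpos_integer c)
  (hbeta : ~ nonpos_integer ((a + c - 1) / 2)) :
  let beta : C := (a + c - 1) / 2 in
  let y : C -> C := fun x => - (4) * x / (1 - x) ^ 2 in
  op_eq
    (fun f =>
       mul_op (fun x => Cpower (1 - x) (2 * beta))
         (hypergeometrization a c
            (mul_op (fun x => Cpower (1 - x) (- (2 * beta))) f)))
    (fun f =>
       hypergeometrization_at beta c y
         (mul_op (fun x => Cpower (1 - y x) (- ((c - a) / 2)))
            (hypergeometrization_at a beta y f))).
Proof.
  intros beta y f [u Hu]. change y with ymap. clear y.
  set (f2 := mul_op (fun x => Cpower (1 - x) (- (2 * beta))) f).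
  set (v := fun n => sum_n (fun k => binom_coef (2 * beta) k * u (n - k)%nat) n : C).
  assert (Hv : has_expansion v f2)
    by exact (has_expansion_mult _ _ _ _ (Cpower_expansion (2 * beta)) Hu).
  set (lv := fun n => v n * (pochhammer a n / pochhammer c n)).
  set (g := hypergeometrization a c f2).
  assert (Hg : has_expansion lv g) by exact (hypergeometrization_spec a c v f2 hc Hv).
  set (L := mul_op (fun x => Cpower (1 - x) (2 * beta)) g).
  assert (HL : analytic0 L).
  { eexists. apply has_expansion_mult; [|exact Hg].
    refine (has_expansion_ext _ _ _ _ (fun n => eq_refl) _ (Cpower_expansion (- (2 * beta)))).
    apply germ_eq_all. intros x. f_equal. ring. }
  assert (Hf : germ_eq f (fun x => Cpower (1 - x) (2 * beta) * f2 x)).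
  { apply germ_eq_all. intros x. unfold f2, mul_op.
    rewrite Cmult_assoc, <- Cpower_plus.
    replace (2 * beta + - (2 * beta)) with (RtoC 0) by ring. rewrite Cpower_0. ring. }
  (* The three factors of the right-hand operator, each followed on the coefficients in y. *)
  destruct (y_coef_expansion beta v f2 f Hv Hf) as [F [HF HFy]].
  assert (H1 := hypergeometrization_spec a beta _ _ hbeta (in_coordinate_spec f F _ HF HFy)).
  set (h1 := hypergeometrization a beta (in_coordinate ymap f)) in H1.
  assert (H2 := has_expansion_mult _ _ _ _ H1 (Cpower_expansion ((c - a) / 2))).
  set (h2 := mul_op (fun x => Cpower (1 - ymap x) (- ((c - a) / 2)))
               (hypergeometrization_at a beta ymap f)).
  assert (H3 := in_coordinate_spec h2 _ _ H2).
  assert (H4 := hypergeometrization_spec beta c _ _ hc (H3 ltac:(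
    apply germ_eq_all; intros x; apply Cmult_comm))).
  set (h4 := hypergeometrization beta c (in_coordinate ymap h2)) in H4.
  (* The left-hand side in the coordinate y. *)
  destruct (y_coef_expansion beta lv g L Hg (germ_eq_refl _)) as [G [HG HGy]].
  assert (H5 : has_expansion (y_coef beta lv) h4).
  { refine (has_expansion_ext _ _ _ _ _ (germ_eq_refl _) H4).
    intros n. etransitivity; [|exact (y_coef_hypergeometrization a c v n hc hbeta)].
    cbv beta. apply (f_equal (fun z : C => z * _)).
    apply sum_n_ext. intros i. apply Cmult_comm. }
  assert (HR : germ_eq L (fun x => h4 (ymap x))).
  { assert (H6 := filter_and _ _ (locally_ymap _ HG) (locally_ymap _ H5)).
    unfold germ_eq. generalize (filter_and _ _ HGy H6). apply filter_imp.
    intros x [E [S1 S2]]. rewrite E. exact (is_pser_unique _ _ _ _ S1 S2). }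
  split; [exact HL|]. split; [|exact HR].
  destruct HL as [w Hw]. exists w.
  exact (has_expansion_ext _ _ _ _ (fun n => eq_refl) HR Hw).
Qed.
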